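(* Let $(\mathcal{A},\varphi)$ be a non-commutative probability space with unit $\mathbf{1}_{\mathcal{A}}$, and suppose that $\mathfrak{p}\in\mathcal{A}$ and $\{\mathfrak{b}_1,\ldots,\mathfrak{b}_k\}\subset\mathcal{A}$ are freely independent. Assume that $\sum_{\ell=1}^k\mathfrak{b}_\ell=\mathbf{1}_{\mathcal{A}}$ and that for each $1\le\ell\le k$ there is a probability measure $\nu_\ell$ on $\mathbb{R}$ with $\varphi(\mathfrak{b}_\ell^n)=\int x^n\,d\nu_\ell(x)$ for all $n\ge1$. Suppose that $\mathfrak{p}\mathfrak{b}_1,\ldots,\mathfrak{p}\mathfrak{b}_k$ are freely independent. (a) If $(\mathfrak{b}_1,\ldots,\mathfrak{b}_k)$ is a free categorical tuple with parameter $(p_1,\ldots,p_k)$ such that $p_i\in(0,1)$ for some $1\le i\le k$, and $\varphi(\mathfrak{p})>0$, then $\mathfrak{p}$ is free Poisson with rate $1$ and jump size $\varphi(\mathfrak{p})$. (b) If $\mathfrak{p}$ is a free Poisson variable with rate $1$, then $(\mathfrak{b}_1,\ldots,\mathfrak{b}_k)$ is a free categorical tuple. Moreover, if $(\mathcal{A},\varphi)$ is a $*$-probability space with a faithful state $\varphi$ and every $\mathfrak{b}_\ell$, $1\le\ell\le k$, is self-adjoint, then $\mathfrak{b}_1,\ldots,\mathfrak{b}_k$ are $k$ mutually orthogonal projections.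
   Context: A non-commutative probability space is a pair $(\mathcal{A},\varphi)$ with $\mathcal{A}$ a unital algebra over $\mathbb{C}$ and $\varphi:\mathcal{A}\to\mathbb{C}$ linear with $\varphi(\mathbf{1}_{\mathcal{A}})=1$. It is a $*$-probability space if $\mathcal{A}$ is a $*$-algebra and $\varphi(a^*a)\ge0$ for all $a$; $\varphi$ is faithful if $\varphi(a^*a)=0$ only for $a=0$. A projection is a self-adjoint idempotent; projections $e,f$ are orthogonal if $ef=0$. Unital subalgebras $(\mathcal{A}_i)_{i\in I}$ are freely independent (free) if $\varphi(a_1\cdots a_r)=0$ whenever $r\ge1$, $a_j\in\mathcal{A}_{i_j}$, $\varphi(a_j)=0$ for all $j$, and $i_1\ne i_2,\ldots,i_{r-1}\ne i_r$. Elements (or sets of elements) are free if the unital subalgebras they generate are free. Free cumulants $\kappa_n:\mathcal{A}^n\to\mathbb{C}$ are the multilinear functionals determined by $\varphi(a_1\cdots a_n)=\sum_{\pi\in NC(n)}\prod_{V\in\pi}\kappa_{|V|}(a_{i}:i\in V)$ (indices in each block in increasing order), where $NC(n)$ is the set of non-crossing partitions of $\{1,\ldots,n\}$; $\kappa_n(a):=\kappa_n(a,\ldots,a)$. $\mathfrak{p}$ is free Poisson with rate $\lambda>0$ and jump size $\alpha>0$ if $\kappa_n(\mathfrak{p})=\lambda\alpha^n$ for all $n\ge1$; it is free Poisson with rate $\lambda$ if this holds for some $\alpha>0$. A tuple $(\mathfrak{b}_1,\ldots,\mathfrak{b}_k)$ is a free categorical tuple with parameter $(p_1,\ldots,p_k)$,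 $p_\ell=\varphi(\mathfrak{b}_\ell)$, if: (i) $\sum_{\ell=1}^k\mathfrak{b}_\ell=\mathbf{1}_{\mathcal{A}}$; (ii) $\varphi(\mathfrak{b}_\ell^n)=\varphi(\mathfrak{b}_\ell)\in[0,1]$ for all $1\le\ell\le k$, $n\ge1$; (iii) $\varphi(\mathfrak{b}_{i_1}^{j_1}\cdots\mathfrak{b}_{i_m}^{j_m})=0$ for all $m\ge2$, $j_1,\ldots,j_m\ge1$ and $i_1,\ldots,i_m\in\{1,\ldots,k\}$ with $i_1\ne i_2,\ i_2\neq i_3,\ldots,i_{m-1}\ne i_m$. *)

(* Defs.v *)
From HB Require Import structures.
From mathcomp Require Import all_boot all_order all_algebra.
From mathcomp Require Import complex.
From mathcomp Require Import all_classical all_reals all_analysis.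

Set Implicit Arguments.
Unset Strict Implicit.
Unset Printing Implicit Defensive.

Import Order.TTheory GRing.Theory Num.Theory.

Local Open Scope classical_set_scope.
Local Open Scope ring_scope.

(* The scalar field is R[i], for R a model of the real numbers. In the order
   of R[i], 0 <= z means that z is real and nonnegative, and 0 <= z <= 1 that
   z is real and belongs to [0, 1].
   A non-commutative probability space is an algebra A over R[i] with a
   linear form phi : {scalar A} such that phi 1 = 1. *)

Section FreeIndependence.
Variables (R : realType) (A : algType R[i]) (phi : {scalar A}).

Definition unital_subalgebra (B : set A) : Prop :=
  [/\ B 1,
      forall x y, B x -> B y -> B (x + y),
      forall (c : R[i]) x, B x -> B (c *: x) &
      forall x y, B x -> B y -> B (x * y)].

Definition generated_subalgebra (S : set A) : set A :=
  smallest unital_subalgebra S.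

Definition consecutive_distinct (I : Type) (r : nat) (i : 'I_r -> I) : Prop :=
  forall s t : 'I_r, t = s.+1 :> nat -> i s <> i t.

Definition free_subalgebras (I : Type) (B : I -> set A) : Prop :=
  forall (r : nat) (i : 'I_r -> I) (a : 'I_r -> A),
    (1 <= r)%N ->
    (forall j, B (i j) (a j)) ->
    (forall j, phi (a j) = 0) ->
    consecutive_distinct i ->
    phi (\prod_(j < r) a j) = 0.

Definition free_sets (I : Type) (S : I -> set A) : Prop :=
  free_subalgebras (fun i => generated_subalgebra (S i)).

Definition free_elements (I : Type) (x : I -> A) : Prop :=
  free_sets (fun i => [set x i]).

Definition free_pair (S T : set A) : Prop :=
  free_sets (fun c : bool => if c then S else T).

End FreeIndependence.

Definition noncrossing (n : nat) (P : {set {set 'I_n}}) : bool :=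
  [forall V in P, forall W in P, (V != W) ==>
    [forall a in V, forall b in W, forall c in V, forall d in W,
      ~~ [&& (a < b)%N, (b < c)%N & (c < d)%N]]].

Definition NC (n : nat) : {set {set {set 'I_n}}} :=
  [set P : {set {set 'I_n}} | finset.partition P [set: 'I_n]%SET & noncrossing P]%SET.

(* The tuple (a_i : i \in V), with indices in increasing order. *)
Definition block_args (T : Type) (n : nat) (a : 'I_n -> T) (V : {set 'I_n}) :
    'I_#|V| -> T :=
  fun j => a (enum_val j).

Section FreeCumulants.
Variables (R : realType) (A : algType R[i]) (phi : {scalar A}).

(* The moment-cumulant formula solved for its one-block term; the remaining
   partitions have blocks of size < n, so that m >= n recursive levels suffice
   to compute the n-th cumulant. *)
Fixpoint free_cumulant_rec (m n : nat) (a : 'I_n -> A) : R[i] :=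
  if m is m'.+1 then
    phi (\prod_(i < n) a i) -
    \sum_(P in NC n | P != [set [set: 'I_n]]%SET)
       \prod_(V in P) free_cumulant_rec m' (block_args a (V := V))
  else 0.

Definition free_cumulant (n : nat) (a : 'I_n -> A) : R[i] :=
  free_cumulant_rec n a.

Definition moment_cumulant (kappa : forall n, ('I_n -> A) -> R[i]) : Prop :=
  forall (n : nat) (a : 'I_n -> A), (1 <= n)%N ->
    phi (\prod_(i < n) a i) =
    \sum_(P in NC n) \prod_(V in P) kappa #|V| (block_args a (V := V)).

Definition free_poisson (x : A) (lambda alpha : R[i]) : Prop :=
  [/\ 0 < lambda, 0 < alpha &
      forall n, (1 <= n)%N ->
        free_cumulant (fun _ : 'I_n => x) = lambda * alpha ^+ n].

Definition free_poisson_rate (x : A) (lambda : R[i]) : Prop :=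
  exists alpha : R[i], free_poisson x lambda alpha.

Definition free_categorical (k : nat) (b : 'I_k -> A) (p : 'I_k -> R[i]) :
    Prop :=
  [/\ forall l, p l = phi (b l),
      \sum_(l < k) b l = 1,
      forall (l : 'I_k) (n : nat), (1 <= n)%N ->
        phi (b l ^+ n) = phi (b l) /\ 0 <= phi (b l) <= 1 &
      forall (m : nat) (i : 'I_m -> 'I_k) (j : 'I_m -> nat),
        (2 <= m)%N ->
        (forall t, (1 <= j t)%N) ->
        consecutive_distinct i ->
        phi (\prod_(t < m) b (i t) ^+ j t) = 0].

(* Only the moments of order n >= 1 are constrained; integrability makes the
   integrals meaningful. *)
Definition has_moments_of (x : A) (nu : probability (measurableTypeR R) R) :
    Prop :=
  forall n : nat, (1 <= n)%N ->
    nu.-integrable setT (fun t : measurableTypeR R => (t ^+ n)%:E) /\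
    phi (x ^+ n) = (Rintegral nu setT (fun t => t ^+ n))%:C%C.

End FreeCumulants.

Section StarAlgebras.
Variables (R : realType) (A : algType R[i]).

Definition star_operation (star : A -> A) : Prop :=
  [/\ forall (c : R[i]) x y, star (c *: x + y) = c^* *: star x + star y,
      forall x y, star (x * y) = star y * star x &
      forall x, star (star x) = x].

Definition star_positive (star : A -> A) (phi : {scalar A}) : Prop :=
  forall a, 0 <= phi (star a * a).

Definition star_faithful (star : A -> A) (phi : {scalar A}) : Prop :=
  forall a, phi (star a * a) = 0 -> a = 0.

Definition self_adjoint (star : A -> A) (x : A) : Prop := star x = x.

Definition projection (star : A -> A) (e : A) : Prop :=
  self_adjoint star e /\ e * e = e.

End StarAlgebras.

(* The functionals free_cumulant are the free cumulants: they are the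
   multilinear solution of the moment-cumulant formula, and the only one. *)
Section FreeCumulantTheory.
Variables (R : realType) (A : algType R[i]) (phi : {scalar A}).
Local Notation kap := (free_cumulant phi).

Lemma kappa_setT (T : Type) (kappa : forall n, ('I_n -> A) -> T)
    (n : nat) (a : 'I_n -> A) :
  kappa #|[set: 'I_n]%SET| (block_args a (V := [set: 'I_n]%SET)) = kappa n a.
Proof.
have en : #|[set: 'I_n]%SET| = n by rewrite cardsT card_ord.
have gen : forall m (e : m = n) (b : 'I_m -> A),
    (forall i, b i = a (cast_ord e i)) -> kappa m b = kappa n a.
  move=> m e; subst m => b hb; congr kappa.
  by apply/funext => i; rewrite hb cast_ord_id.
apply: (gen _ en) => i; rewrite /block_args; congr a.
apply: val_inj => /=.
rewrite /enum_val; set x0 := enum_default i.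
have -> : enum [set: 'I_n]%SET = enum 'I_n.
  by apply: eq_enum => x; rewrite !inE.
by rewrite nth_enum_ord // -[ltnRHS]en.
Qed.

Lemma noncrossing_setT n : (1 <= n)%N -> [set [set: 'I_n]]%SET \in NC n.
Proof.
move=> n1; rewrite inE; apply/andP; split.
  apply/and3P; split; first by rewrite /finset.cover big_set1.
    exact: finset.trivIset1.
  rewrite inE eq_sym -cards_eq0 cardsT card_ord; by rewrite -lt0n.
by apply/forall_inP => V /set1P ->; apply/forall_inP => W /set1P ->; rewrite eqxx.
Qed.

Lemma NC_block_card n (P : {set {set 'I_n}}) (V : {set 'I_n}) :
  P \in NC n -> V \in P -> (0 < #|V|)%N.
Proof.
rewrite inE => /andP[/and3P[_ _ h0] _] hV.
by rewrite card_gt0; apply: contraNneq h0 => <-.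
Qed.

Lemma NC_block_lt n (P : {set {set 'I_n}}) (V : {set 'I_n}) :
  P \in NC n -> P != [set [set: 'I_n]]%SET -> V \in P -> (#|V| < n)%N.
Proof.
move=> hpi hne hV; rewrite -[ltnRHS]card_ord ltn_neqAle max_card andbT.
apply: contra hne; rewrite -cardsT => /eqP hc.
have VT : V = [set: 'I_n]%SET.
  by apply/eqP; rewrite eqEcard finset.subsetT hc leqnn.
move: hpi; rewrite inE => /andP[/and3P[_ /finset.trivIsetP htriv h0] _].
rewrite finset.eqEsubset finset.sub1set -VT hV andbT.
apply/fintype.subsetP => W hW; rewrite inE.
apply: contraT => hWV; have := htriv _ _ hW hV hWV.
rewrite VT -finset.setI_eq0 finset.setIT => /eqP W0.
by move: h0; rewrite -W0 hW.
Qed.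

Lemma free_cumulant_rec_fuel m m' n (a : 'I_n -> A) :
  (1 <= n)%N -> (n <= m)%N -> (n <= m')%N ->
  free_cumulant_rec phi m a = free_cumulant_rec phi m' a.
Proof.
elim: m m' n a => [|m IH] [|m'] n a n1 hm hm' //=.
- by move: (leq_trans n1 hm).
- by move: (leq_trans n1 hm').
congr (_ - _); apply: eq_bigr => P /andP[hpi hne]; apply: eq_bigr => V hV.
have hlt := NC_block_lt hpi hne hV.
apply: IH; first exact: NC_block_card hV.
- by rewrite -ltnS; apply: leq_trans hm.
- by rewrite -ltnS; apply: leq_trans hm'.
Qed.

Lemma free_cumulantE n (a : 'I_n -> A) : (1 <= n)%N ->
  kap a = phi (\prod_(i < n) a i) -
    \sum_(P in NC n | P != [set [set: 'I_n]]%SET)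
       \prod_(V in P) kap (block_args a (V := V)).
Proof.
case: n a => // n a _; rewrite {1}/free_cumulant /=; congr (_ - _).
apply: eq_bigr => P /andP[hpi hne]; apply: eq_bigr => V hV.
apply: free_cumulant_rec_fuel => //; first exact: NC_block_card hV.
by have := NC_block_lt hpi hne hV.
Qed.

Lemma free_cumulant_moment : moment_cumulant phi (@free_cumulant R A phi).
Proof.
move=> n a n1; rewrite (bigD1 [set [set: 'I_n]]%SET) ?noncrossing_setT //=.
by rewrite big_set1 (kappa_setT (@free_cumulant R A phi)) free_cumulantE // subrK.
Qed.

Lemma free_cumulant_unique (kappa : forall n, ('I_n -> A) -> R[i]) :
  moment_cumulant phi kappa ->
  forall n (a : 'I_n -> A), (1 <= n)%N -> kappa n a = kap a.
Proof.
move=> hk n; elim/ltn_ind: n => n IH a n1; rewrite free_cumulantE // hk //.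
rewrite (bigD1 [set [set: 'I_n]]%SET) ?noncrossing_setT //= big_set1.
rewrite kappa_setT; apply/esym/eqP; rewrite subr_eq; apply/eqP; congr (_ + _).
apply: eq_bigr => P /andP[hpi hne]; apply: eq_bigr => V hV.
by apply: IH; [exact: NC_block_lt hV | exact: NC_block_card hV].
Qed.

Lemma prod_multilinear n (a b d : 'I_n -> A) (i : 'I_n) (c : R[i]) :
  a i = c *: b i + d i ->
  (forall j, j != i -> b j = a j /\ d j = a j) ->
  \prod_(j < n) a j = c *: \prod_(j < n) b j + \prod_(j < n) d j.
Proof.
elim: n a b d i => [|n IH] a b d i; first by case: i.
move=> hi hj; rewrite !big_ord_recl.
have [i0|[i' ei]] : i = ord0 \/ exists i', i = lift ord0 i'.
  by case: (unliftP ord0 i) => [i' ->|->]; [right; exists i'|left].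
- have hb : \prod_(j < n) b (lift ord0 j) = \prod_(j < n) a (lift ord0 j).
    by apply: eq_bigr => j _; have [] := hj (lift ord0 j); rewrite ?i0.
  have hd : \prod_(j < n) d (lift ord0 j) = \prod_(j < n) a (lift ord0 j).
    by apply: eq_bigr => j _; have [] := hj (lift ord0 j); rewrite ?i0.
  by rewrite hb hd -i0 hi mulrDl scalerAl.
- have [hb hd] : b ord0 = a ord0 /\ d ord0 = a ord0 by apply: hj; rewrite ei.
  rewrite hb hd.
  rewrite (IH _ (fun j => b (lift ord0 j)) (fun j => d (lift ord0 j)) i') -?ei //.
    by rewrite mulrDr scalerAr.
  by move=> j hji; apply: hj; rewrite ei (inj_eq lift_inj).
Qed.

Lemma free_cumulant_multilinear n (a b d : 'I_n -> A) (i : 'I_n) (c : R[i]) :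
  a i = c *: b i + d i ->
  (forall j, j != i -> b j = a j /\ d j = a j) ->
  kap a = c * kap b + kap d.
Proof.
elim/ltn_ind: n a b d i => n IH a b d i hi hj.
have n1 : (1 <= n)%N by apply: leq_ltn_trans (ltn_ord i).
rewrite !free_cumulantE // (prod_multilinear hi hj) linearP /=.
rewrite mulrBr addrACA -opprD; congr (_ - _).
rewrite mulr_sumr -big_split /=; apply: eq_bigr => P /andP[hP hne].
have hpart : finset.partition P [set: 'I_n]%SET.
  by move: hP; rewrite inE => /andP[].
have /and3P[/eqP hcov htriv _] := hpart.
have icov : i \in finset.cover P by rewrite hcov inE.
set V := finset.pblock P i.
have hV : V \in P by exact: finset.pblock_mem.
have iV : i \in V by rewrite finset.mem_pblock.
rewrite !(bigD1 V hV) /=.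
have other e (he : forall j, j != i -> e j = a j) :
  \prod_(W in P | W != V) kap (block_args e (V := W)) =
  \prod_(W in P | W != V) kap (block_args a (V := W)).
  apply: eq_bigr => W /andP[hW hWV]; congr free_cumulant; apply/funext => j.
  apply: he; apply: contra hWV => /eqP ej; apply/eqP.
  by rewrite /V (finset.def_pblock htriv hW) // -ej enum_valP.
rewrite (other b) => [|j /hj[]//]; rewrite (other d) => [|j /hj[]//].
rewrite mulrA -mulrDl; congr (_ * _).
apply: (IH _ (NC_block_lt hP hne hV) _ _ _ (enum_rank_in iV i)).
  by rewrite /block_args enum_rankK_in.
move=> j hji; apply: hj; apply: contra hji => /eqP ej.
by apply/eqP/enum_val_inj; rewrite enum_rankK_in.
Qed.

End FreeCumulantTheory.

(* Main.v *)
Require Import Defs.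
From mathcomp Require Import all_boot all_order all_algebra.
From mathcomp Require Import complex.
From mathcomp Require Import all_classical all_reals all_analysis.
From mathcomp Require Import ring lra.

Set Implicit Arguments.
Unset Strict Implicit.
Unset Printing Implicit Defensive.

Import Order.TTheory GRing.Theory Num.Theory.

Local Open Scope classical_set_scope.
Local Open Scope ring_scope.

(** The theorem rests on two descriptions of the moments of the words in the
    elements [p * b l].

    Let [M] be the noncommutative generating series of these moments, and [K] the
    series [\sum_s kappa_(s.+1)(p) u^s] of the free cumulants of [p].  Since [p] is
    free from the [b l], one has [M = 1 + K u], where [u] solves
    [u = phi (b (1 - K b)^-1)]; multiplying by [K], also
    [M = 1 + phi (b K) + phi (b K b K) + ...] ([free_pair_moments]).  Since the
    [p * b l] are free, [M = 1 + \sum_l R_l(M)], where [R_l] involves the cumulants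
    of [p * b l] alone ([phi_geom_add]).  Both follow directly from the definition
    of freeness, by a device of Haagerup: for suitable coefficients the resolvent
    of a product or of a sum of free elements factors so that it becomes a sum of
    alternating words in centered elements, of which only the empty one has a
    nonzero moment.

    If [p] is free Poisson of rate 1 and jump size [alpha], then
    [kappa_s(p) = alpha ^+ s] and [M = 1 + K u] turns into [K = alpha M].  Comparing
    the two expansions of [M] word by word, [alpha ^+ n * phi (b_w)] is the cumulant
    of the word [w] in the [p * b l], and vanishes for nonconstant [w]
    ([poisson_word_cumulants]).  As the [b l] add up to 1, this makes
    [phi (b l ^+ n)] independent of [n >= 1]; equality of the first two moments of a
    probability measure puts their value in [[0, 1]].  For a faithful state,
    [b l * b l - b l] and [b l * b m] have square norm 0.

    If conversely the [b l] form a free categorical tuple, the moment of the word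
    [m i i ... i] is computed twice: freeness of the [p * b l] factors off the
    first letter, and freeness of [p] from the [b l] expresses it by [K].
    This gives [K = alpha M] in one coefficient for each length, with
    [alpha = phi p], and with [phi (b i)] and [phi (b m)] different from 0 the
    cumulants of [p] are found one after the other ([categorical_cumulants]).

    Series in noncommuting variables are represented by upper triangular
    matrices: with the letters of a word on the superdiagonal, the entries of the
    powers are the coefficients of its subwords, and all expansions are finite.
    Freeness passes to matrices with entries in the free subalgebras
    ([free_matrix_word]).  The cumulants enter by the centered polynomials of
    [cumulant_polynomials].  To connect these with the sum over noncrossing
    partitions it suffices, for cumulants [alpha ^+ n], to count these partitions:
    their number is a Catalan number ([card_NC]), and moments
    [alpha ^+ n * catalan n] mean that the polynomials formed with [alpha ^+ n] are
    centered ([catalan_momentsP]). *)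

(** * Noncrossing partitions and Catalan numbers *)

Section NoncrossingCount.
Variable N : nat.
Implicit Types (x y z : 'I_N) (V W B D E : {set 'I_N}) (P Q : {set {set 'I_N}}).

(** Membership form of being a partition, for partitions assembled from blocks
    that are only known through their elements. *)
Lemma partitionP P D : reflect
  [/\ forall V x, V \in P -> x \in V -> x \in D,
      forall V, V \in P -> exists x, x \in V,
      forall x, x \in D -> exists2 V, V \in P & x \in V &
      forall V W x, V \in P -> W \in P -> x \in V -> x \in W -> V = W]
  (finset.partition P D).
Proof.
apply: (iffP idP) => [hP|[h1 h2 h3 h4]].
  have /and3P[/eqP hc ht h0] := hP; split.
  - by move=> V x VP xV; rewrite -hc; apply/finset.bigcupP; exists V.
  - by move=> V VP; apply/finset.set0Pn; apply: contraNneq h0 => <-.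
  - by move=> x; rewrite -hc => /finset.bigcupP[V VP xV]; exists V.
  - move=> V W x VP WP xV xW.
    by rewrite -(finset.def_pblock ht VP xV) (finset.def_pblock ht WP xW).
apply/and3P; split.
- apply/eqP/setP => x; apply/finset.bigcupP/idP => [[V VP xV]|/h3[V VP xV]].
    exact: h1 xV.
  by exists V.
- apply/finset.trivIsetP => V W VP WP; apply: contraR => /pred0Pn[x /andP[xV xW]].
  by apply/eqP; apply: (h4 _ _ x).
- by apply/negP => /h2[x]; rewrite inE.
Qed.

Lemma noncrossingP P : reflect
  (forall V W, V \in P -> W \in P -> V != W ->
    forall a b c d : 'I_N, a \in V -> b \in W -> c \in V -> d \in W ->
      (a < b)%N -> (b < c)%N -> (c < d)%N -> False)
  (noncrossing P).
Proof.
apply: (iffP idP) => [h V W VP WP VW a b c d aV bW cV dW ab bc cd|h].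
  move: h => /forall_inP/(_ V VP)/forall_inP/(_ W WP)/implyP/(_ VW).
  move=> /forall_inP/(_ a aV)/forall_inP/(_ b bW)/forall_inP/(_ c cV).
  by move=> /forall_inP/(_ d dW); rewrite ab bc cd.
apply/forall_inP => V VP; apply/forall_inP => W WP; apply/implyP => VW.
apply/forall_inP => a aV; apply/forall_inP => b bW; apply/forall_inP => c cV.
by apply/forall_inP => d dW; apply/negP => /and3P[]; apply: (h V W).
Qed.

(** Noncrossing partitions of an arbitrary subset: this keeps the counting
    recursion below inside one ambient ordinal. *)
Definition noncrossing_partitions D : {set {set {set 'I_N}}} :=
  [set P | finset.partition P D & noncrossing P]%SET.

Lemma partition_subset_eq P Q D :
  finset.partition P D -> finset.partition Q D -> P \subset Q -> P = Q.
Proof.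
move=> /partitionP[p1 p2 p3 p4] /partitionP[q1 q2 q3 q4] /fintype.subsetP PQ.
apply/setP => V; apply/idP/idP => [/PQ //|VQ].
have [x xV] := q2 _ VQ.
have [W WP xW] := p3 _ (q1 _ _ VQ xV).
by rewrite (q4 V W x) // PQ.
Qed.

Definition restriction P E : {set {set 'I_N}} :=
  [set V :&: E | V in P]%SET :\ finset.set0.

Lemma restriction_noncrossing P D E : P \in noncrossing_partitions D ->
  E \subset D -> restriction P E \in noncrossing_partitions E.
Proof.
rewrite !inE => /andP[/partitionP[p1 p2 p3 p4] /noncrossingP pn].
move=> /fintype.subsetP ED; apply/andP; split.
  apply/partitionP; split.
  - by move=> V x /setD1P[_ /imsetP[V' _ ->]] /setIP[].
  - by move=> V /setD1P[/finset.set0Pn].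
  - move=> x xE; have [V VP xV] := p3 _ (ED _ xE).
    have xI : x \in (V :&: E)%SET by rewrite inE xV.
    exists (V :&: E)%SET => //; apply/setD1P; split; last exact: imset_f.
    by apply/finset.set0Pn; exists x.
  - move=> V W x /setD1P[_ /imsetP[V' VP ->]] /setD1P[_ /imsetP[W' WP ->]].
    by move=> /setIP[xV _] /setIP[xW _]; rewrite (p4 V' W' x).
apply/noncrossingP => V W /setD1P[_ /imsetP[V' VP ->]] /setD1P[_ /imsetP[W' WP ->]] VW.
move=> a b c d /setIP[aV _] /setIP[bW _] /setIP[cV _] /setIP[dW _].
apply: (pn V' W') aV bW cV dW => //.
by apply: contraNneq VW => ->.
Qed.

Definition below D y : {set 'I_N} := [set z in D | (z < y)%N]%SET.
Definition above D y : {set 'I_N} := [set z in D | (y < z)%N]%SET.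

(** The inverse of restricting a partition to the elements below and above [y],
    when [y] ends the block of [x].  For [x = y] nothing below [y] is left, and
    the value [set0] that [pblock] takes off the cover makes [y] a block of its
    own. *)
Definition glue x y P1 P2 : {set {set 'I_N}} :=
  ((y |: finset.pblock P1 x) |: (P1 :\ finset.pblock P1 x) :|: P2)%SET.

Definition ends_first_block D x y : {set {set {set 'I_N}}} :=
  [set P in noncrossing_partitions D | (y \in finset.pblock P x) &&
    [forall z in finset.pblock P x, (z <= y)%N]]%SET.

Lemma pblockE P D V x : finset.partition P D -> V \in P -> x \in V ->
  finset.pblock P x = V.
Proof. by case/and3P => _ ht _; apply: finset.def_pblock. Qed.

Lemma pblock_out P D x : finset.partition P D -> x \notin D ->
  finset.pblock P x = finset.set0.
Proof.
case/and3P => /eqP hc _ _ xD; apply/eqP.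
apply: contraR xD; rewrite -hc /finset.pblock => /finset.set0Pn[z].
case: pickP => [V /= /andP[VP xV] _|_]; last by rewrite inE.
by apply/finset.bigcupP; exists V.
Qed.

Lemma pblock_in P D x : finset.partition P D -> x \in D ->
  finset.pblock P x \in P /\ x \in finset.pblock P x.
Proof.
by case/and3P => /eqP hc _ _ xD; rewrite finset.mem_pblock hc finset.pblock_mem ?hc.
Qed.

Section Glue.
Variables (D : {set 'I_N}) (x y : 'I_N).
Hypotheses (xD : x \in D) (xmin : forall z, z \in D -> (x <= z)%N).
Hypothesis yD : y \in D.

Lemma glue_ends P1 P2 :
  P1 \in noncrossing_partitions (below D y) ->
  P2 \in noncrossing_partitions (above D y) ->
  glue x y P1 P2 \in ends_first_block D x y.
Proof.
rewrite !inE => /andP[hp1 /noncrossingP n1] /andP[hp2 /noncrossingP n2].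
have /partitionP[p1 p2 p3 p4] := hp1; have /partitionP[q1 q2 q3 q4] := hp2.
set B := finset.pblock P1 x.
have lo V z : V \in P1 -> z \in V -> z \in D /\ (z < y)%N.
  by move=> VP zV; move: (p1 _ _ VP zV); rewrite inE => /andP[].
have hi V z : V \in P2 -> z \in V -> z \in D /\ (y < z)%N.
  by move=> VP zV; move: (q1 _ _ VP zV); rewrite inE => /andP[].
have hB : (B = finset.set0 /\ x = y) \/ (B \in P1 /\ x \in B).
  have [xy|xy] := boolP (x < y)%N.
    by right; apply: pblock_in hp1 _; rewrite inE xD.
  left; split; first by apply: pblock_out hp1 _; rewrite inE (negbTE xy) andbF.
  by apply/val_inj/eqP; rewrite /= eqn_leq xmin // leqNgt.
have Blo z : z \in B -> z \in D /\ (z < y)%N.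
  by case: hB => [[-> _]|[BP _]]; [rewrite inE|exact: lo].
have mem V : V \in glue x y P1 P2 ->
    [\/ V = (y |: B)%SET, V \in P1 /\ V != B | V \in P2].
  rewrite /glue -/B => /setUP[/setU1P[->|/setD1P[VB VP]]|VP].
  - by constructor 1.
  - by constructor 2.
  - by constructor 3.
have memC : (y |: B)%SET \in glue x y P1 P2 by rewrite !inE eqxx.
have xC : x \in (y |: B)%SET.
  by rewrite !inE; case: hB => [[_ ->]|[_ ->]]; rewrite ?eqxx ?orbT.
have hpart : finset.partition (glue x y P1 P2) D.
  apply/partitionP; split.
  - move=> V z /mem[->|[VP _]|VP]; last 2 first.
    + by move=> /(lo _ _ VP)[].
    + by move=> /(hi _ _ VP)[].
    + by rewrite !inE => /orP[/eqP->//|/Blo[]].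
  - move=> V /mem[->|[VP _]|VP]; [by exists y; rewrite !inE eqxx|exact: p2|exact: q2].
  - move=> z zD; case: (ltngtP z y) => [zy|yz|zy].
    + have [V VP zV] : exists2 V, V \in P1 & z \in V by apply: p3; rewrite inE zD.
      have [VB|VB] := eqVneq V B.
        by exists (y |: B)%SET => //; rewrite inE -VB zV orbT.
      by exists V => //; rewrite !inE VB VP orbT.
    + have [V VP zV] : exists2 V, V \in P2 & z \in V by apply: q3; rewrite inE zD.
      by exists V => //; rewrite inE VP orbT.
    + by exists (y |: B)%SET => //; rewrite !inE -val_eqE /= zy eqxx.
  - have CP1 V z : V \in P1 -> V != B -> z \in (y |: B)%SET -> z \in V -> False.
      move=> VP VB; rewrite !inE => /orP[/eqP->|zB zV].
        by move=> /(lo _ _ VP)[_]; rewrite ltnn.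
      case: hB => [[B0 _]|[BP _]]; first by rewrite B0 inE in zB.
      by move: VB; rewrite (p4 V B z) ?eqxx.
    have CP2 V z : V \in P2 -> z \in (y |: B)%SET -> z \in V -> False.
      move=> VP; rewrite !inE => /orP[/eqP->|zB] /(hi _ _ VP)[_]; rewrite ?ltnn //.
      by have [_ /ltn_trans h /h] := Blo _ zB; rewrite ltnn.
    have P12 V W z : V \in P1 -> W \in P2 -> z \in V -> z \in W -> False.
      move=> VP WP /(lo _ _ VP)[_ zy] /(hi _ _ WP)[_ /(ltn_trans zy)].
      by rewrite ltnn.
    move=> V W z /mem[->|[VP VB]|VP] /mem[->|[WP WB]|WP] // zV zW.
    + by case: (CP1 W z).
    + by case: (CP2 W z).
    + by case: (CP1 V z).
    + exact: (p4 _ _ z).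
    + by case: (P12 V W z).
    + by case: (CP2 V z).
    + by case: (P12 W V z).
    + exact: (q4 _ _ z).
have hnc : noncrossing (glue x y P1 P2).
  apply/noncrossingP => V W /mem[->|[VP VB]|VP] /mem[->|[WP WB]|WP] VW a b c d;
    first by rewrite eqxx in VW.
  - move=> aC bW cC dW ab bc cd.
    have [_ dy] := lo _ _ WP dW.
    have inB z : z \in (y |: B)%SET -> (z < y)%N -> z \in B.
      by rewrite !inE => /orP[/eqP->|//]; rewrite ltnn.
    have cB : c \in B by apply: inB => //; apply: ltn_trans dy.
    have aB : a \in B.
      by apply: inB => //; apply: ltn_trans ab (ltn_trans bc (ltn_trans cd dy)).
    case: hB => [[B0 _]|[BP _]]; first by rewrite B0 inE in aB.
    by apply: (n1 B W) aB bW cB dW ab bc cd; rewrite // eq_sym.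
  - move=> aC bW cC dW ab bc cd.
    have [_ yb] := hi _ _ WP bW.
    move: cC; rewrite !inE => /orP[/eqP cy|/Blo[_ cy]].
      by move: (ltn_trans yb bc); rewrite cy ltnn.
    by move: (ltn_trans (ltn_trans yb bc) cy); rewrite ltnn.
  - move=> aV bC cV dC ab bc cd.
    (* a crossing that uses y also exists with x in front instead of y *)
    have [aD _] := lo _ _ VP aV; have [_ cy] := lo _ _ VP cV.
    have bB : b \in B.
      move: bC; rewrite !inE => /orP[/eqP by_|//].
      by move: (ltn_trans bc cy); rewrite by_ ltnn.
    case: hB => [[B0 _]|[BP xB]]; first by rewrite B0 inE in bB.
    have xa : (x < a)%N.
      rewrite ltn_neqAle xmin // andbT; apply: contra VB => /eqP xa.
      by apply/eqP/(p4 _ _ a) => //; rewrite -(val_inj xa : x = a).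
    by apply: (n1 B V) xB aV bB cV xa ab bc; rewrite // eq_sym.
  - by move=> aV bW cV dW ab bc cd; apply: (n1 V W) aV bW cV dW ab bc cd.
  - move=> /(lo _ _ VP)[_ ay] /(hi _ _ WP)[_ yb] /(lo _ _ VP)[_ cy] _ ab bc _.
    by move: (ltn_trans (ltn_trans yb bc) cy); rewrite ltnn.
  - move=> /(hi _ _ VP)[_ ya] + /(hi _ _ VP)[_ yc] + ab bc cd.
    rewrite !inE => /orP[/eqP by_|/Blo[_ by_]] _.
      by move: (ltn_trans ya ab); rewrite by_ ltnn.
    by move: (ltn_trans (ltn_trans ya ab) by_); rewrite ltnn.
  - move=> /(hi _ _ VP)[_ ya] /(lo _ _ WP)[_ yb] _ _ ab _ _.
    by move: (ltn_trans (ltn_trans ya ab) yb); rewrite ltnn.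
  - by move=> aV bW cV dW ab bc cd; apply: (n2 V W) aV bW cV dW ab bc cd.
rewrite hpart hnc /= (pblockE hpart memC xC) !inE eqxx /=.
by apply/forall_inP => z; rewrite !inE => /orP[/eqP-> //|/Blo[_ /ltnW]].
Qed.

Lemma restriction_glue P1 P2 :
  P1 \in noncrossing_partitions (below D y) ->
  P2 \in noncrossing_partitions (above D y) ->
  restriction (glue x y P1 P2) (below D y) = P1 /\
  restriction (glue x y P1 P2) (above D y) = P2.
Proof.
move=> h1 h2; have hg := glue_ends h1 h2.
have {hg}hg : glue x y P1 P2 \in noncrossing_partitions D.
  by move: hg; rewrite inE => /andP[].
have sub1 : below D y \subset D by apply/fintype.subsetP => z; rewrite inE => /andP[].
have sub2 : above D y \subset D by apply/fintype.subsetP => z; rewrite inE => /andP[].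
have := restriction_noncrossing hg sub1; have := restriction_noncrossing hg sub2.
move: h1 h2; rewrite !inE => /andP[hp1 _] /andP[hp2 _] /andP[hr2 _] /andP[hr1 _].
have /partitionP[p1 p2 p3 p4] := hp1; have /partitionP[q1 q2 q3 q4] := hp2.
set B := finset.pblock P1 x.
split; apply/esym; apply: partition_subset_eq; try eassumption;
  apply/fintype.subsetP => V VP; apply/setD1P; split.
- by apply/finset.set0Pn; apply: p2.
- have [VB|VB] := eqVneq V B; last first.
    apply/imsetP; exists V; first by rewrite !inE -/B VB VP orbT.
    by apply/esym/finset.setIidPl; apply/fintype.subsetP => z; apply: p1.
  apply/imsetP; exists (y |: B)%SET; first by rewrite !inE eqxx.
  apply/setP => z; rewrite !inE -VB; apply/idP/idP => [zV|].
    by rewrite zV orbT /=; move: (p1 _ _ VP zV); rewrite inE.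
  by move=> /andP[/orP[/eqP->|//]]; rewrite ltnn andbF.
- by apply/finset.set0Pn; apply: q2.
- apply/imsetP; exists V; first by rewrite inE VP orbT.
  by apply/esym/finset.setIidPl; apply/fintype.subsetP => z; apply: q1.
Qed.

(** A block with elements on both sides of [y] would cross the block that
    contains [x] and [y]; so every other block lies below or above [y]. *)
Lemma glue_restriction P : P \in ends_first_block D x y ->
  [/\ restriction P (below D y) \in noncrossing_partitions (below D y),
      restriction P (above D y) \in noncrossing_partitions (above D y) &
      glue x y (restriction P (below D y)) (restriction P (above D y)) = P].
Proof.
rewrite inE => /andP[hP /andP[yC /forall_inP Cy]].
have sub1 : below D y \subset D by apply/fintype.subsetP => z; rewrite inE => /andP[].
have sub2 : above D y \subset D by apply/fintype.subsetP => z; rewrite inE => /andP[].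
have h1 := restriction_noncrossing hP sub1.
have h2 := restriction_noncrossing hP sub2; split => //.
have hg := glue_ends h1 h2.
move: hP hg; rewrite !inE => /andP[hp /noncrossingP np] /andP[/andP[hg _] _].
have /partitionP[p1 p2 p3 p4] := hp.
have [CP xC] := pblock_in hp xD.
set C := finset.pblock P x in yC Cy CP xC *.
apply/esym; apply: partition_subset_eq hp hg _.
set P1 := restriction P (below D y); set P2 := restriction P (above D y).
have hp1 : finset.partition P1 (below D y) by move: h1; rewrite inE => /andP[].
have hB : finset.pblock P1 x = (C :\ y)%SET.
  have [xy|xy] := boolP (x < y)%N; last first.
    have {}xy : x = y by apply/val_inj/eqP; rewrite /= eqn_leq xmin // leqNgt.
    rewrite (pblock_out hp1) ?inE ?xy ?ltnn ?andbF //.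
    apply/esym/eqP; rewrite -finset.subset0; apply/fintype.subsetP => z.
    rewrite !inE => /andP[zy zC]; case/negP: zy; apply/eqP/val_inj/eqP => /=.
    by rewrite eqn_leq Cy //= -xy xmin // (p1 C).
  apply: (pblockE hp1); last by rewrite !inE xC andbT neq_ltn xy.
  have CE : (C :\ y = C :&: below D y)%SET.
    apply/setP => z; rewrite !inE; apply/andP/and3P => [[zy zC]|[zC zD zy]].
      by rewrite zC (p1 C) //; split => //; rewrite ltn_neqAle zy Cy.
    by rewrite zC -val_eqE /= neq_ltn zy.
  apply/setD1P; split; last by rewrite CE; apply: imset_f.
  by apply/finset.set0Pn; exists x; rewrite !inE xC andbT neq_ltn xy.
apply/fintype.subsetP => V VP; rewrite /glue hB finset.setD1K //.
have [->|VC] := eqVneq V C; first by rewrite !inE eqxx.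
have neC z : z \in V -> z \notin C.
  by move=> zV; apply: contra VC => zC; apply/eqP/(p4 _ _ z).
have CV : C != V by rewrite eq_sym.
have [v vV] := p2 _ VP.
have vC := neC _ vV.
have vy : v != y by apply: contraNneq vC => ->.
have res E : V \subset E -> V \in restriction P E.
  move=> VE; apply/setD1P; split; first by apply/finset.set0Pn; exists v.
  by apply/imsetP; exists V => //; apply/esym/finset.setIidPl.
have xlt z : z \in V -> (x < z)%N.
  move=> zV; rewrite ltn_neqAle xmin ?andbT ?(p1 V) //.
  by apply: contraTneq xC => xz; rewrite (val_inj xz : x = z) neC.
have [vlt|vgt] := boolP (v < y)%N.
  suff VE : V \subset below D y.
    rewrite inE; apply/orP; left; rewrite inE; apply/orP; right.
    rewrite inE res // andbT inE; apply: contraTneq vV => ->.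
    by rewrite inE (negbTE vC) andbF.
  apply/fintype.subsetP => z zV; rewrite inE (p1 V) //= ltnNge.
  apply/negP; rewrite leq_eqVlt => /orP[/eqP yz|yz].
    by move: (neC _ zV); rewrite -(val_inj yz : y = z) yC.
  exact: (np C V CP VP CV _ _ _ _ xC vV yC zV (xlt _ vV)).
suff VE : V \subset above D y by rewrite inE res ?orbT.
apply/fintype.subsetP => z zV; rewrite inE (p1 V) //= ltnNge.
have {}vgt : (y < v)%N by rewrite ltn_neqAle eq_sym vy leqNgt.
apply/negP; rewrite leq_eqVlt => /orP[/eqP yz|yz].
  by move: (neC _ zV); rewrite (val_inj yz : z = y) yC.
exact: (np C V CP VP CV _ _ _ _ xC zV yC vV (xlt _ zV)).
Qed.

Lemma card_ends_first_block :
  #|ends_first_block D x y| =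
  (#|noncrossing_partitions (below D y)| * #|noncrossing_partitions (above D y)|)%N.
Proof.
rewrite -cardsX.
have -> : ends_first_block D x y = [set glue x y pr.1 pr.2 | pr in
    finset.setX (noncrossing_partitions (below D y))
                (noncrossing_partitions (above D y))]%SET.
  apply/setP => P; apply/idP/imsetP => [/glue_restriction[h1 h2 h3]|].
    exists (restriction P (below D y), restriction P (above D y)) => //.
    by apply/setXP.
  by move=> [[P1 P2] /setXP[h1 h2] ->]; apply: glue_ends.
apply: card_in_imset => [[P1 P2] [Q1 Q2]] /setXP[/= h1 h2] /setXP[/= h3 h4] e.
have [e1 e2] := restriction_glue h1 h2; have [e3 e4] := restriction_glue h3 h4.
by congr pair; [rewrite -e1 e e3|rewrite -e2 e e4].
Qed.

End Glue.

Lemma card_noncrossing_rec D x : x \in D -> (forall z, z \in D -> (x <= z)%N) ->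
  #|noncrossing_partitions D| = (\sum_(y in D)
    #|noncrossing_partitions (below D y)| * #|noncrossing_partitions (above D y)|)%N.
Proof.
move=> xD xmin.
under [RHS]eq_bigr => y yD do rewrite -(card_ends_first_block xD xmin yD) -sum1_card.
rewrite -sum1_card.
rewrite [RHS](exchange_big_dep (mem (noncrossing_partitions D))) /=; last first.
  by move=> y P _; rewrite inE => /andP[].
apply: eq_bigr => P hP.
have hp : finset.partition P D by move: hP; rewrite inE => /andP[].
have [CP xC] := pblock_in hp xD.
have /partitionP[p1 _ _ _] := hp.
case: (arg_maxnP (fun z : 'I_N => z : nat) xC) => y yC ymax.
have {}yC : y \in finset.pblock P x by [].
rewrite (bigD1 y) /=; last first.
  rewrite (p1 _ _ CP yC) inE hP yC /=.
  by apply/forall_inP => z /ymax.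
rewrite big1 ?addn0 // => z /andP[/andP[zD]].
rewrite inE => /andP[_ /andP[zC /forall_inP zmax]] /negP[].
apply/eqP/val_inj/eqP; rewrite /= eqn_leq.
by move: (ymax _ zC) (zmax _ yC) => /= -> ->.
Qed.

Lemma sum_rank (f : nat -> nat) D :
  (\sum_(y in D) f #|below D y| = \sum_(i < #|D|) f i)%N.
Proof.
have [m] := ubnP #|D|; elim: m D => // m IH D; rewrite ltnS => Dm.
have [->|/finset.set0Pn[v vD]] := eqVneq D finset.set0.
  by rewrite big_set0 cards0 big_ord0.
case: (arg_maxnP (fun z : 'I_N => z : nat) vD) => y yD ymax.
have {}yD : y \in D by [].
rewrite (cardsD1 y) yD add1n big_ord_recr /= (big_setD1 y) //= addnC.
have be : below D y = (D :\ y)%SET.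
  apply/setP => z; rewrite !inE; apply/andP/andP => [[zD zy]|[zy zD]]; split => //.
    by rewrite -val_eqE /= neq_ltn zy.
  by rewrite ltn_neqAle zy; apply: ymax.
rewrite be -IH; last by move: Dm; rewrite (cardsD1 y) yD add1n.
congr addn; apply: eq_bigr => z; rewrite !inE => /andP[zy zD]; congr f.
apply: eq_card => w; rewrite !inE; case: eqVneq => [->|//] /=.
have {}zy : (z <= y)%N by apply: ymax.
by rewrite ltnNge zy andbF.
Qed.

End NoncrossingCount.

Lemma noncrossing_partitions_setT n :
  noncrossing_partitions [set: 'I_n]%SET = NC n.
Proof. by []. Qed.

Fixpoint catalan_seq (n : nat) : seq nat :=
  if n is m.+1 then
    let s := catalan_seq m in
    rcons s (\sum_(i < m.+1) nth 0 s i * nth 0 s (m - i))%N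
  else [:: 1%N].

Definition catalan (n : nat) : nat := nth 0%N (catalan_seq n) n.

Lemma size_catalan_seq n : size (catalan_seq n) = n.+1.
Proof. by elim: n => //= n IH; rewrite size_rcons IH. Qed.

Lemma nth_catalan_seq n i : (i <= n)%N -> nth 0%N (catalan_seq n) i = catalan i.
Proof.
elim: n => [|n IH]; first by rewrite leqn0 => /eqP->.
rewrite leq_eqVlt => /orP[/eqP->//|hi].
by rewrite /= nth_rcons size_catalan_seq hi IH.
Qed.

Lemma catalanS n :
  catalan n.+1 = (\sum_(i < n.+1) catalan i * catalan (n - i))%N.
Proof.
rewrite {1}/catalan /= nth_rcons size_catalan_seq ltnn eqxx.
by apply: eq_bigr => i _; rewrite !nth_catalan_seq ?leq_subr // -ltnS.
Qed.

(** Split a noncrossing partition at the last element [y] of the block of the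
    least element: the elements below [y] and those above [y] are partitioned
    independently, which is the recursion of the Catalan numbers. *)
Lemma card_noncrossing_partitions N (D : {set 'I_N}) :
  #|noncrossing_partitions D| = catalan #|D|.
Proof.
have [m] := ubnP #|D|; elim: m D => // m IH D; rewrite ltnS => Dm.
have [->|/finset.set0Pn[v vD]] := eqVneq D finset.set0.
  rewrite cards0; transitivity #|[set (finset.set0 : {set {set 'I_N}})]%SET|;
    last by rewrite cards1.
  apply: eq_card => P; rewrite !inE finset.partition_set0.
  case: eqVneq => [->|//]; apply/forall_inP => V; by rewrite inE.
case: (arg_minnP (fun z : 'I_N => z : nat) vD) => x xD xmin.
have {}xD : x \in D by [].
rewrite (card_noncrossing_rec xD xmin).
have cardD y : y \in D -> #|D| = (#|below D y| + #|above D y|).+1.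
  move=> yD; rewrite (cardsD1 y) yD add1n; congr S.
  have I0 : (below D y :&: above D y)%SET = finset.set0.
    by apply/setP => z; rewrite !inE; case: ltngtP; rewrite ?andbF.
  rewrite -cardsUI I0 cards0 addn0; apply: eq_card => z.
  by rewrite !inE -andb_orr andbC -val_eqE /= neq_ltn.
have [n Dn] : exists n, #|D| = n.+1 by exists #|D|.-1; rewrite (cardD v vD).
rewrite Dn catalanS -Dn -(sum_rank (fun i => (catalan i * catalan (n - i))%N)).
apply: eq_bigr => y yD; have := cardD y yD; rewrite Dn => -[->].
by rewrite addKn !IH // (leq_trans _ Dm) // (cardD y yD) ltnS ?leq_addr ?leq_addl.
Qed.

Lemma card_NC n : #|NC n| = catalan n.
Proof.
by rewrite -noncrossing_partitions_setT card_noncrossing_partitions cardsT card_ord.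
Qed.

(** * Triangular matrices as truncated power series *)

Section UpperTriangular.
Variables (S : nzRingType) (n : nat).
Implicit Types (X Y Z : 'M[S]_n.+1).

(** These matrices play the part of noncommutative power series without terms
    of degree less than [j]: when the superdiagonal carries the letters of a
    word, entry [(a, b)] collects the coefficient of the subword from [a] to
    [b]. *)
Definition upper (j : nat) X : Prop :=
  forall a b : 'I_n.+1, (b < a + j)%N -> X a b = 0.

Lemma upper_le i j X : (i <= j)%N -> upper j X -> upper i X.
Proof.
by move=> ij hX a b hab; apply: hX; apply: leq_trans hab _; rewrite leq_add2l.
Qed.

Lemma upper_top X : upper n.+1 X -> X = 0.
Proof.
move=> hX; apply/matrixP => a b; rewrite mxE; apply: hX.
exact: leq_trans (ltn_ord b) (leq_addl _ _).
Qed.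

Lemma upper_0 j : upper j 0.
Proof. by move=> a b _; rewrite mxE. Qed.

Lemma upperD j X Y : upper j X -> upper j Y -> upper j (X + Y).
Proof. by move=> hX hY a b hab; rewrite mxE hX ?hY ?addr0. Qed.

Lemma upperN j X : upper j X -> upper j (- X).
Proof. by move=> hX a b hab; rewrite mxE hX ?oppr0. Qed.

Lemma upperB j X Y : upper j X -> upper j Y -> upper j (X - Y).
Proof. by move=> hX hY; apply: upperD hX (upperN hY). Qed.

Lemma upper_sum j (I : Type) (r : seq I) (P : pred I) (f : I -> 'M[S]_n.+1) :
  (forall i, P i -> upper j (f i)) -> upper j (\sum_(i <- r | P i) f i).
Proof. by move=> h; elim/big_ind: _ => //; [exact: upper_0|exact: upperD]. Qed.

Lemma upperM i j X Y : upper i X -> upper j Y -> upper (i + j) (X * Y).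
Proof.
move=> hX hY a b hab; rewrite mxE big1 // => c _.
have [hc|hc] := ltnP c (a + i)%N; first by rewrite hX ?mul0r.
rewrite [Y c b]hY ?mulr0 //; apply: leq_trans hab _.
by rewrite addnA leq_add2r.
Qed.

Lemma upper_scalar (x : S) : upper 0 (x%:M : 'M[S]_n.+1).
Proof. by move=> a b; rewrite addn0 mxE => hab; rewrite -val_eqE /= gtn_eqF. Qed.

Lemma upper_1 : upper 0 (1 : 'M[S]_n.+1).
Proof. exact: upper_scalar. Qed.

Lemma upperX k X : upper 1 X -> upper k (X ^+ k).
Proof.
by move=> hX; elim: k => [|k IH]; [exact: upper_1|rewrite exprS -add1n; exact: upperM].
Qed.

Lemma upper0X k X : upper 0 X -> upper 0 (X ^+ k).
Proof.
move=> hX; elim: k => [|k IH]; first exact: upper_1.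
by rewrite exprS -[0%N]addn0; apply: upperM.
Qed.

Lemma upper0M j X Y : upper 0 X -> upper j Y -> upper j (X * Y).
Proof. exact: upperM. Qed.

Lemma upperM0 j X Y : upper j X -> upper 0 Y -> upper j (X * Y).
Proof. by move=> hX hY; rewrite -[j]addn0; apply: upperM. Qed.

Lemma upper_nilpotent X : upper 1 X -> X ^+ n.+1 = 0.
Proof. by move=> hX; apply: upper_top; apply: upperX. Qed.

(** Only one path from [a] to [b] has steps of lengths at least [i] and [j]. *)
Lemma upperM_entry i j X Y (a c b : 'I_n.+1) : upper i X -> upper j Y ->
  c = (a + i)%N :> nat -> b = (c + j)%N :> nat ->
  (X * Y) a b = X a c * Y c b.
Proof.
move=> hX hY hc hb; rewrite mxE (bigD1 c) //= big1 ?addr0 // => d dc.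
have [hd|hd] := ltnP d (a + i)%N; first by rewrite hX ?mul0r.
rewrite [Y d b]hY ?mulr0 // hb ltn_add2r ltn_neqAle hc hd andbT.
by rewrite -hc eq_sym; apply: contra dc => /eqP e; apply/eqP/val_inj.
Qed.

(** The inverse of [1 - X] for [X] without constant term, by nilpotency. *)
Definition geom X := \sum_(k < n.+1) X ^+ k.

Lemma upper_geom X : upper 0 X -> upper 0 (geom X).
Proof. by move=> hX; apply: upper_sum => k _; apply: upper0X. Qed.

Lemma geomE X : upper 1 X -> geom X = 1 + X * geom X.
Proof.
move=> hX; rewrite {2}/geom big_distrr /= big_ord_recr /= -exprS.
rewrite upper_nilpotent // addr0 /geom big_ord_recl expr0; congr (_ + _).
by apply: eq_bigr => k _; rewrite -exprS.
Qed.

Lemma geomEr X : upper 1 X -> geom X = 1 + geom X * X.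
Proof.
move=> hX; rewrite {1}geomE //; congr (_ + _).
rewrite /geom big_distrr big_distrl /=; apply: eq_bigr => k _.
by rewrite -exprS -exprSr.
Qed.

Lemma mul1B_geom X : upper 1 X -> (1 - X) * geom X = 1.
Proof. by move=> hX; rewrite mulrBl mul1r {1}geomE // addrK. Qed.

Lemma geom_mul1B X : upper 1 X -> geom X * (1 - X) = 1.
Proof. by move=> hX; rewrite mulrBr mulr1 {1}geomEr // addrK. Qed.

Lemma geom_unique X Y : upper 1 X -> (1 - X) * Y = 1 -> Y = geom X.
Proof.
by move=> hX hY; rewrite -[Y]mul1r -(geom_mul1B hX) -mulrA hY mulr1.
Qed.

Lemma upperM_congr j X X' Y Y' : upper 0 X -> upper 0 Y' ->
  upper j (X - X') -> upper j (Y - Y') -> upper j (X * Y - X' * Y').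
Proof.
move=> hX hY' hXX hYY.
have -> : X * Y - X' * Y' = X * (Y - Y') + (X - X') * Y'.
  by rewrite mulrBr mulrBl addrA subrK.
by apply: upperD; [exact: upper0M|exact: upperM0].
Qed.

Lemma upperX_congr j k X X' : upper 0 X -> upper 0 X' ->
  upper j (X - X') -> upper j (X ^+ k - X' ^+ k).
Proof.
move=> hX hX' hXX; elim: k => [|k IH]; first by rewrite subrr; exact: upper_0.
by rewrite !exprS; apply: upperM_congr => //; apply: upper0X.
Qed.

Lemma geom_congr j X X' : upper 0 X -> upper 0 X' ->
  upper j (X - X') -> upper j (geom X - geom X').
Proof.
move=> hX hX' hXX; rewrite -sumrB; apply: upper_sum => k _.
exact: upperX_congr.
Qed.

(** A map that gains one degree has a fixed point, here reached after finitely
    many iterations. *)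
Lemma upper_fixpoint (f : 'M[S]_n.+1 -> 'M[S]_n.+1) :
  (forall X, upper 1 X -> upper 1 (f X)) ->
  (forall j X Y, upper 1 X -> upper 1 Y ->
     upper j (X - Y) -> upper j.+1 (f X - f Y)) ->
  exists2 X, upper 1 X & f X = X.
Proof.
move=> f1 fc; pose it k := iter k f 0.
have it1 k : upper 1 (it k) by rewrite /it; elim: k => [|k IH]; [exact: upper_0|exact: f1].
have itc k : upper k (it k.+1 - it k).
  elim: k => [|k IH]; last by apply: (fc k (it k.+1) (it k)).
  by apply: (upper_le (leq0n 1)); apply: upperB; [apply: (it1 1%N)|apply: (it1 0%N)].
exists (it n.+1) => //; apply/eqP; rewrite -subr_eq0; apply/eqP.
exact: upper_top (itc n.+1).
Qed.

End UpperTriangular.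

(** The hypothesis discards the terms of the double sum whose total degree is
    out of range. *)
Lemma truncated_cauchy_product (V : nmodType) N (f : nat -> nat -> V) :
  (forall s m, (N <= s + m)%N -> f s m = 0) ->
  \sum_(k < N) \sum_(s < k.+1) f s (k - s)%N = \sum_(s < N) \sum_(m < N) f s m.
Proof.
move=> f0.
have inner k (hk : (k < N)%N) :
    \sum_(s < k.+1) f s (k - s)%N = \sum_(s < N) \sum_(m < N | (s + m)%N == k) f s m.
  rewrite -(big_mkord xpredT (fun s => f s (k - s)%N)) (big_nat_widen _ _ N) //.
  rewrite big_mkord big_mkcond /=; apply: eq_bigr => s _; rewrite ltnS.
  case: leqP => [sk|ks]; last first.
    by rewrite big_pred0 // => m; apply/negbTE; rewrite neq_ltn (leq_trans ks) ?leq_addr ?orbT.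
  have hm : (k - s < N)%N by apply: leq_ltn_trans hk; apply: leq_subr.
  rewrite (big_pred1 (Ordinal hm)) // => m; rewrite /= -val_eqE /=.
  by rewrite -(eqn_add2l s m) subnKC.
under eq_bigr => k _ do rewrite inner //.
rewrite exchange_big; apply: eq_bigr => s _ /=.
rewrite (exchange_big_dep xpredT) //=; apply: eq_bigr => m _.
have [h|h] := ltnP (s + m)%N N.
  by rewrite (big_pred1 (Ordinal h)) // => k; rewrite /= -val_eqE /= eq_sym.
by rewrite f0 // big1.
Qed.

Section MatrixAmplification.
Variables (R : realType) (A : algType R[i]) (phi : {scalar A}) (n : nat).
Local Notation C := R[i].
Implicit Types (D E : 'M[C]_n.+1) (X Y : 'M[A]_n.+1) (x : A).

(** The embedded coefficients [lift_mx D] commute with the elements of [A] put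
    on the diagonal, and [phi_mx] is a bimodule map over them, as a conditional
    expectation is over the algebra onto which it projects. *)
Definition lift_mx D : 'M[A]_n.+1 := map_mx (in_alg A) D.
Definition phi_mx X : 'M[C]_n.+1 := map_mx phi X.

Lemma lift_mx1 : lift_mx 1 = 1.
Proof. exact: rmorph1. Qed.

Lemma lift_mx0 : lift_mx 0 = 0.
Proof. exact: rmorph0. Qed.

Lemma lift_mxM D E : lift_mx (D * E) = lift_mx D * lift_mx E.
Proof. exact: rmorphM. Qed.

Lemma lift_mxD D E : lift_mx (D + E) = lift_mx D + lift_mx E.
Proof. exact: rmorphD. Qed.

Lemma lift_mxB D E : lift_mx (D - E) = lift_mx D - lift_mx E.
Proof. exact: rmorphB. Qed.

Lemma lift_mx_sum (I : Type) (r : seq I) (P : pred I) (f : I -> 'M[C]_n.+1) :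
  lift_mx (\sum_(i <- r | P i) f i) = \sum_(i <- r | P i) lift_mx (f i).
Proof. exact: rmorph_sum. Qed.

Lemma phi_mxD X Y : phi_mx (X + Y) = phi_mx X + phi_mx Y.
Proof. exact: raddfD. Qed.

Lemma phi_mxB X Y : phi_mx (X - Y) = phi_mx X - phi_mx Y.
Proof. exact: raddfB. Qed.

Lemma phi_mx_sum (I : Type) (r : seq I) (P : pred I) (f : I -> 'M[A]_n.+1) :
  phi_mx (\sum_(i <- r | P i) f i) = \sum_(i <- r | P i) phi_mx (f i).
Proof. exact: raddf_sum. Qed.

Lemma phi_mx_liftl D X : phi_mx (lift_mx D * X) = D * phi_mx X.
Proof.
apply/matrixP => a b; rewrite !mxE raddf_sum; apply: eq_bigr => c _.
by rewrite !mxE /= mulr_algl linearZ.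
Qed.

Lemma phi_mx_liftr D X : phi_mx (X * lift_mx D) = phi_mx X * D.
Proof.
apply/matrixP => a b; rewrite !mxE raddf_sum; apply: eq_bigr => c _.
by rewrite !mxE /= mulr_algr linearZ mulrC.
Qed.

Lemma mul_scalars x x' : (x%:M : 'M[A]_n.+1) * x'%:M = (x * x')%:M.
Proof. by rewrite scalar_mxM. Qed.

Lemma lift_comm x D : x%:M * lift_mx D = lift_mx D * x%:M.
Proof.
apply/matrixP => a b; rewrite !mxE (bigD1 a) //= [RHS](bigD1 b) //= !big1.
- by rewrite !addr0 !mxE !eqxx !mulr1n /= mulr_algl mulr_algr.
- by move=> c cb; rewrite !mxE (negbTE cb) mulr0.
- by move=> c ca; rewrite !mxE eq_sym (negbTE ca) mul0r.
Qed.

Lemma phi_mx_scalar_lift x D : phi_mx (x%:M * lift_mx D) = phi x *: D.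
Proof.
rewrite phi_mx_liftr -mul_scalar_mx; congr (_ * _).
by apply/matrixP => a b; rewrite !mxE; case: eqVneq => _; rewrite ?mulr1n ?mulr0n ?linear0.
Qed.

Lemma lift_mxZ (c : C) D : lift_mx (c *: D) = (c%:A)%:M * lift_mx D.
Proof.
rewrite -mul_scalar_mx lift_mxM; congr (_ * _).
by apply/matrixP => a b; rewrite !mxE rmorphMn.
Qed.

Hypothesis phi1 : phi 1 = 1.

Lemma phi_mx_lift D : phi_mx (lift_mx D) = D.
Proof. by rewrite -[lift_mx D]mul1r phi_mx_scalar_lift phi1 scale1r. Qed.

Lemma upper_lift j D : upper j D -> upper j (lift_mx D).
Proof. by move=> hD a b hab; rewrite mxE hD // rmorph0. Qed.

Lemma upper_phi j X : upper j X -> upper j (phi_mx X).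
Proof. by move=> hX a b hab; rewrite mxE hX // linear0. Qed.

End MatrixAmplification.

(** * Freeness with matrix coefficients *)

Section Subalgebras.
Variables (R : realType) (A : algType R[i]).
Implicit Types (B : set A) (x y : A).

Lemma generated_subalgebra_unital (S : set A) :
  unital_subalgebra (generated_subalgebra S).
Proof.
split=> [B [[]]//|x y hx hy B hB|c x hx B hB|x y hx hy B hB].
- by have [[_ h _ _] _] := hB; apply: h; [apply: hx|apply: hy].
- by have [[_ _ h _] _] := hB; apply: h; apply: hx.
- by have [[_ _ _ h] _] := hB; apply: h; [apply: hx|apply: hy].
Qed.

Lemma generated_subalgebra_mem (S : set A) x : S x -> generated_subalgebra S x.
Proof. by move=> hx B [_]; apply. Qed.

Variables (B : set A) (hB : unital_subalgebra B).

Lemma subalgebra0 : B 0.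
Proof. by have [h1 _ hZ _] := hB; rewrite -(scale0r 1); apply: hZ. Qed.

Lemma subalgebraN x : B x -> B (- x).
Proof. by have [_ _ hZ _] := hB; rewrite -scaleN1r; apply: hZ. Qed.

Lemma subalgebra_sum (I : Type) (r : seq I) (P : pred I) (f : I -> A) :
  (forall i, P i -> B (f i)) -> B (\sum_(i <- r | P i) f i).
Proof.
by have [_ hD _ _] := hB => h; elim/big_ind: _ => //; exact: subalgebra0.
Qed.

Variable n : nat.
Implicit Types X Y : 'M[A]_n.+1.

Definition entries_in X : Prop := forall a b, B (X a b).

Lemma entries_inD X Y : entries_in X -> entries_in Y -> entries_in (X + Y).
Proof. by have [_ h _ _] := hB => hX hY a b; rewrite mxE; apply: h. Qed.

Lemma entries_inN X : entries_in X -> entries_in (- X).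
Proof. by move=> hX a b; rewrite mxE; apply: subalgebraN. Qed.

Lemma entries_inM X Y : entries_in X -> entries_in Y -> entries_in (X * Y).
Proof.
have [_ _ _ h] := hB => hX hY a b; rewrite mxE.
by apply: subalgebra_sum => c _; apply: h.
Qed.

Lemma entries_in_lift (D : 'M[R[i]]_n.+1) : entries_in (lift_mx A D).
Proof. by have [h1 _ h _] := hB => a b; rewrite mxE; apply: h. Qed.

Lemma entries_in_scalar x : B x -> entries_in (x%:M).
Proof.
by move=> hx a b; rewrite mxE; case: eqP => _ //=; rewrite ?mulr0n; exact: subalgebra0.
Qed.

Lemma entries_in_sum (I : Type) (r : seq I) (P : pred I) (f : I -> 'M[A]_n.+1) :
  (forall i, P i -> entries_in (f i)) -> entries_in (\sum_(i <- r | P i) f i).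
Proof.
move=> h a b; rewrite summxE; apply: subalgebra_sum => i hi; exact: h.
Qed.

Lemma entries_inX X k : entries_in X -> entries_in (X ^+ k).
Proof.
have [h1 _ _ _] := hB => hX; elim: k => [|k IH]; last by rewrite exprS; apply: entries_inM.
exact: entries_in_scalar.
Qed.

Lemma entries_in_geom X : entries_in X -> entries_in (geom X).
Proof. by move=> hX; apply: entries_in_sum => k _; apply: entries_inX. Qed.

End Subalgebras.

Section FreeWords.
Variables (R : realType) (A : algType R[i]) (phi : {scalar A}).
Variables (I : eqType) (B : I -> set A).
Hypothesis B_free : free_subalgebras phi B.

Definition alternating (s : seq I) : bool := sorted (fun i j => i != j) s.

Lemma free_word (s : seq (I * A)) : s != [::] -> alternating [seq x.1 | x <- s] ->
  (forall x, x \in s -> B x.1 x.2 /\ phi x.2 = 0) -> phi (\prod_(x <- s) x.2) = 0.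
Proof.
case: s => [//|x0 s _]; set t := x0 :: s => alt ht.
rewrite (big_nth x0) big_mkord.
apply: (B_free (i := fun j : 'I_(size t) => (nth x0 t j).1)
          (a := fun j : 'I_(size t) => (nth x0 t j).2)) => //.
- by move=> j; have [] := ht _ (mem_nth x0 (ltn_ord j)).
- by move=> j; have [] := ht _ (mem_nth x0 (ltn_ord j)).
move=> j l hl; apply/eqP; rewrite hl.
have h : (j.+1 < size t)%N by rewrite -hl.
move: alt; rewrite /alternating => /(sortedP x0.1) /(_ j).
by rewrite size_map => /(_ h); rewrite !(nth_map x0) // ltnW.
Qed.

Variable n : nat.

Definition centered (x : I * 'M[A]_n.+1) : Prop :=
  entries_in (B x.1) x.2 /\ phi_mx phi x.2 = 0.

(** Freeness with matrix coefficients: every entry of a product of centered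
    matrices is a sum of products of centered elements. *)
Lemma free_matrix_word (s : seq (I * 'M[A]_n.+1)) : s != [::] ->
  alternating [seq x.1 | x <- s] -> (forall x, x \in s -> centered x) ->
  phi_mx phi (\prod_(x <- s) x.2) = 0.
Proof.
move=> s0 alt cs; apply/matrixP => a b; rewrite mxE [RHS]mxE.
suff gen (t : seq (I * A)) (u : seq (I * 'M[A]_n.+1)) c : (0 < size t + size u)%N ->
    alternating ([seq x.1 | x <- t] ++ [seq x.1 | x <- u]) ->
    (forall x, x \in t -> B x.1 x.2 /\ phi x.2 = 0) ->
    (forall x, x \in u -> centered x) ->
    phi (\prod_(x <- t) x.2 * (\prod_(x <- u) x.2) c b) = 0.
  have := gen [::] s a; rewrite big_nil mul1r; apply=> //.
  by rewrite add0n lt0n size_eq0.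
elim: u t c => [|[i X] u IH] t c.
  rewrite addn0 cats0 big_nil => t0 alt_t ct _.
  rewrite mxE; case: eqP => _; last by rewrite mulr0n mulr0 linear0.
  by rewrite mulr1n mulr1 free_word // -size_eq0 -lt0n.
move=> _ alt_tu ct cu; rewrite big_cons mxE mulr_sumr raddf_sum big1 // => d _.
have := IH (rcons t (i, X c d)) d; rewrite -cats1 big_cat big_seq1 /= -mulrA.
apply.
- by rewrite size_cat /= addnAC addn1.
- by rewrite map_cat /= -catA.
- have [hX pX] := cu (i, X) (mem_head _ _).
  move=> x; rewrite mem_cat inE => /orP[/ct//|/eqP->] /=; split; first exact: hX.
  by move/matrixP/(_ c d): pX; rewrite !mxE.
- by move=> x xu; apply: cu; rewrite inE xu orbT.
Qed.

End FreeWords.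

(** * Free cumulants through centered polynomials *)

Section CumulantPolynomials.
Variables (R : realType) (A : algType R[i]) (phi : {scalar A}).
Hypothesis phi1 : phi 1 = 1.
Variable x : A.
Local Notation C := R[i].

(** The recursion says that the [q m] have the generating series
    [(1 + \sum_m kappa m y^m.+1 - x y)^-1].  That [phi] maps this series to 1 is
    one form of the definition of the R-transform, so that [kappa m] is the free
    cumulant of order [m.+1] of [x]. *)
Definition cumulant_polynomials (kappa : nat -> C) (q : nat -> A) : Prop :=
  [/\ q 0%N = 1,
      forall m, x * q m = q m.+1 + \sum_(s < m.+1) kappa s *: q (m - s)%N &
      forall m, phi (q m.+1) = 0].

Lemma cumulant_recursion (k : nat -> A -> C) : exists2 q : nat -> A, q 0%N = 1 &
  forall m, x * q m = q m.+1 + \sum_(s < m.+1) k s (q s) *: q (m - s)%N.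
Proof.
pose step (l : seq A) (m : nat) :=
  x * nth 0 l m - \sum_(s < m.+1) k s (nth 0 l s) *: nth 0 l (m - s)%N.
pose l := fix l m := if m is m'.+1 then rcons (l m') (step (l m') m') else [:: 1].
have sl m : size (l m) = m.+1 by elim: m => //= m IH; rewrite size_rcons IH.
pose q m := nth 0 (l m) m.
have nl m i : (i <= m)%N -> nth 0 (l m) i = q i.
  elim: m => [|m IH]; first by rewrite leqn0 => /eqP->.
  rewrite leq_eqVlt => /orP[/eqP->//|hi].
  by rewrite /= nth_rcons sl hi IH.
exists q => // m; rewrite {2}/q /= nth_rcons sl ltnn eqxx /step nl //.
set r := \sum_(s < _) _; rewrite [X in _ - r + X](_ : _ = r) ?subrK //.
by apply: eq_bigr => s _; rewrite !nl ?leq_subr // -ltnS.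
Qed.

(** With [kappa m = phi (x * q m)], the recursion itself makes the next
    polynomial centered once the previous ones are. *)
Lemma cumulant_polynomials_exist : exists kappa q, cumulant_polynomials kappa q.
Proof.
have [q q0 qS] := cumulant_recursion (fun _ y => phi (x * y)).
exists (fun s => phi (x * q s)), q; split=> //.
elim/ltn_ind => m IH.
have := congr1 phi (qS m); rewrite raddfD raddf_sum /= big_ord_recr /= subnn q0.
rewrite linearZ /= phi1 mulr1 big1 ?add0r => [/eqP|s _].
  by rewrite -subr_eq subrr eq_sym => /eqP.
rewrite linearZ /=; have [j hj] : exists j, (m - s = j.+1)%N.
  by exists (m - s).-1; rewrite prednK // subn_gt0.
by rewrite hj IH ?mulr0 // -hj leq_subr.
Qed.

Variables (kappa : nat -> C) (q : nat -> A).
Hypothesis q_polys : cumulant_polynomials kappa q.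

Lemma cumulant_polynomials_mem (B : set A) m :
  unital_subalgebra B -> B x -> B (q m).
Proof.
move=> hB Bx; have [q0 qS _] := q_polys; have [B1 hD hZ hM] := hB.
elim/ltn_ind: m => -[|m] IH; first by rewrite q0.
have -> : q m.+1 = x * q m - \sum_(s < m.+1) kappa s *: q (m - s)%N.
  by rewrite qS addrK.
apply: hD; first by apply: hM => //; apply: IH.
apply: subalgebraN => //; apply: subalgebra_sum => // s _; apply: hZ; apply: IH.
by rewrite ltnS leq_subr.
Qed.

Lemma cumulant_polynomials_comm m : x * q m = q m * x.
Proof.
apply: (cumulant_polynomials_mem (B := [set y | x * y = y * x])) => //; split=> /=.
- by rewrite mulr1 mul1r.
- by move=> y z hy hz; rewrite mulrDr mulrDl hy hz.
- by move=> c y hy; rewrite -scalerAr -scalerAl hy.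
- by move=> y z hy hz; rewrite mulrA hy -mulrA hz mulrA.
Qed.

Variable n : nat.
Variable y : 'M[C]_n.+1.
Hypothesis y1 : upper 1 y.

Definition cumulant_series : 'M[C]_n.+1 := \sum_(s < n.+1) kappa s *: y ^+ s.

Definition centered_series : 'M[A]_n.+1 :=
  \sum_(m < n.+1) (q m.+1)%:M * lift_mx A (y ^+ m).

Local Notation K := cumulant_series.
Local Notation Z := centered_series.
Local Notation "^ D" := (lift_mx A D) (at level 8, format "^ D").

Lemma upper_cumulant_series : upper 0 K.
Proof.
apply: upper_sum => s _ a b hab; rewrite mxE (upper0X _ (upper_le (leq0n 1) y1)) //.
by rewrite mulr0.
Qed.

Lemma upper_centered_series : upper 0 Z.
Proof.
apply: upper_sum => m _; apply: upper0M; first exact: upper_scalar.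
exact: upper_lift (upper0X _ (upper_le (leq0n 1) y1)).
Qed.

Lemma phi_centered_series : phi_mx phi Z = 0.
Proof.
have [_ _ qc] := q_polys; rewrite phi_mx_sum big1 // => m _.
by rewrite phi_mx_scalar_lift qc scale0r.
Qed.

Lemma centered_series_in (B : set A) :
  unital_subalgebra B -> B x -> entries_in B Z.
Proof.
move=> hB Bx; apply: entries_in_sum => // m _; apply: entries_inM => //.
  by apply: entries_in_scalar => //; apply: cumulant_polynomials_mem.
exact: entries_in_lift.
Qed.

Lemma cumulant_series_comm : K * y = y * K.
Proof.
rewrite mulr_suml mulr_sumr; apply: eq_bigr => s _.
by rewrite -scalerAl -scalerAr -exprSr exprS.
Qed.

(** Shifting the index shows that [1 + Z y] is the generating series of all
    the [q m], whose term of top degree vanishes because [y] is nilpotent. *)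
Lemma centered_seriesS : 1 + Z * ^y = \sum_(m < n.+1) (q m)%:M * ^(y ^+ m).
Proof.
have [q0 _ _] := q_polys.
transitivity (\sum_(m < n.+2) (q m)%:M * ^(y ^+ m)).
  rewrite big_ord_recl q0 expr0 lift_mx1 mulr1; congr (_ + _).
  rewrite mulr_suml; apply: eq_bigr => m _.
  by rewrite -mulrA -lift_mxM -exprSr.
by rewrite big_ord_recr /= upper_nilpotent // lift_mx0 mulr0 addr0.
Qed.

Local Notation c := (x%:M - ^K).

Lemma series_lift_comm D : D * y = y * D -> Z * ^D = ^D * Z.
Proof.
move=> hD; rewrite mulr_suml mulr_sumr; apply: eq_bigr => m _.
rewrite mulrA -lift_comm -!mulrA -!lift_mxM; congr (_ * lift_mx A _).
by apply/esym/commrX.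
Qed.

(** The recursion of the polynomials, summed up in one identity of series. *)
Lemma series_mulr : c * (1 + Z * ^y) = Z.
Proof.
have [q0 qS _] := q_polys.
rewrite mulrBl; apply/eqP; rewrite subr_eq; apply/eqP; rewrite centered_seriesS.
pose f s m := (kappa s *: q m)%:M * ^(y ^+ (s + m)).
transitivity (Z + \sum_(k < n.+1) \sum_(s < k.+1) f s (k - s)%N).
  rewrite /Z mulr_sumr -big_split /=; apply: eq_bigr => m _.
  rewrite mulrA mul_scalars qS raddfD mulrDl; congr (_ + _).
  rewrite raddf_sum mulr_suml; apply: eq_bigr => s _.
  by rewrite /f subnKC // -ltnS.
rewrite truncated_cauchy_product => [|s m hsm]; last first.
  by rewrite /f -(subnKC hsm) exprD upper_nilpotent // mul0r lift_mx0 mulr0.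
congr (_ + _); rewrite /K lift_mx_sum mulr_suml; apply: eq_bigr => s _.
rewrite mulr_sumr; apply: eq_bigr => m _.
rewrite /f lift_mxZ mulrA -[_ * _ * (q m)%:M]mulrA -lift_comm !mulrA mul_scalars.
by rewrite mulr_algl -mulrA -lift_mxM -exprD.
Qed.

Lemma series_comm : c * Z = Z * c.
Proof.
rewrite mulrBl mulrBr -series_lift_comm ?cumulant_series_comm //; congr (_ - _).
rewrite mulr_sumr mulr_suml; apply: eq_bigr => m _.
by rewrite mulrA mul_scalars cumulant_polynomials_comm -mul_scalars -!mulrA lift_comm.
Qed.

Lemma c_lift_comm : c * ^y = ^y * c.
Proof. by rewrite mulrBl mulrBr lift_comm -!lift_mxM cumulant_series_comm. Qed.

Lemma series_mull : (1 + Z * ^y) * c = Z.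
Proof.
rewrite -[RHS]series_mulr mulrDl mul1r [RHS]mulrDr mulr1; congr (_ + _).
by rewrite -[LHS]mulrA -c_lift_comm [LHS]mulrA [RHS]mulrA series_comm.
Qed.

Lemma series_inverser : (1 - c * ^y) * (1 + Z * ^y) = 1.
Proof.
rewrite mulrBl mul1r -mulrA; set Q := 1 + _.
have -> : ^y * Q = Q * ^y.
  by rewrite /Q mulrDl mulrDr mul1r mulr1 mulrA -series_lift_comm.
by rewrite mulrA series_mulr /Q addrK.
Qed.

Lemma series_inversel : (1 + Z * ^y) * (1 - c * ^y) = 1.
Proof. by rewrite mulrBr mulr1 mulrA series_mull addrK. Qed.

End CumulantPolynomials.

(** * Products of free elements *)

Section MultiplicativeFreeness.
Variables (R : realType) (A : algType R[i]) (phi : {scalar A}).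
Hypothesis phi1 : phi 1 = 1.
Local Notation C := R[i].
Variables (B : bool -> set A) (p : A) (kappa : nat -> C) (q : nat -> A).
Hypotheses (B_unital : forall c, unital_subalgebra (B c)) (Bp : B true p).
Hypothesis B_free : free_subalgebras phi B.
Hypothesis q_polys : cumulant_polynomials phi p kappa q.
Variable n : nat.
Variable b : 'M[A]_n.+1.
Hypotheses (b1 : upper 1 b) (Bb : entries_in (B false) b).
Local Notation "^ D" := (lift_mx A D) (at level 8, format "^ D").
Local Notation K u := (cumulant_series kappa u).

(** The subordination function of the product of [p] with [b]: the equation
    that makes [Y] below centered. *)
Definition subordinate (u : 'M[C]_n.+1) : Prop :=
  u = phi_mx phi (b * geom (^(K u) * b)).

Lemma subordinate_exists : exists2 u, upper 1 u & subordinate u.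
Proof.
have up0 u : upper 1 u -> upper 0 (^(K u) * b).
  move=> hu; apply: upper0M; first exact/upper_lift/upper_cumulant_series.
  exact: upper_le (leq0n 1) b1.
have [u hu e] : exists2 u, upper 1 u & phi_mx phi (b * geom (^(K u) * b)) = u.
  apply: upper_fixpoint => [u hu|j u v hu hv huv].
    by apply/upper_phi/upperM0 => //; apply: upper_geom; apply: up0.
  rewrite -phi_mxB -mulrBr; apply: upper_phi; rewrite -add1n; apply: upperM => //.
  apply: geom_congr; [exact: up0|exact: up0|].
  rewrite -mulrBl -lift_mxB; apply: upperM0; last exact: upper_le (leq0n 1) b1.
  apply: upper_lift; rewrite -sumrB; apply: upper_sum => s _.
  move=> i l hil; rewrite -scalerBr mxE (upperX_congr _ _ _ huv) ?mulr0 //.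
    exact: upper_le (leq0n 1) hu.
  exact: upper_le (leq0n 1) hv.
by exists u.
Qed.

Section Subordinate.
Variable u : 'M[C]_n.+1.
Hypotheses (u1 : upper 1 u) (hu : subordinate u).
Local Notation k := (K u).
Local Notation Z := (centered_series q u).
Local Notation L := (geom (^k * b)).
Local Notation Y := (b * L - ^u).

Let kb1 : upper 1 (^k * b).
Proof. by apply: upper0M => //; apply/upper_lift/upper_cumulant_series. Qed.

Let Y1 : upper 1 Y.
Proof.
apply: upperB; last exact: upper_lift.
by apply: upperM0 => //; apply: upper_geom; apply: upper_le (leq0n 1) kb1.
Qed.

Let ZY1 : upper 1 (Z * Y).
Proof. by apply: upper0M => //; apply: upper_centered_series. Qed.

(** Up to factors that depend on [p] alone or on [b] alone, [1 - p b] is [1 - Z Y]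
    with [Z] and [Y] centered; this is the multiplicative analogue of the trick by
    which Haagerup derives the additivity of the R-transform. *)
Lemma resolvent_factorization :
  geom (p%:M * b) = L * geom (Z * Y) * (1 + Z * ^u).
Proof.
have pb1 : upper 1 (p%:M * b) by apply: upper0M => //; apply: upper_scalar.
apply/esym/(geom_unique pb1).
set c := p%:M - ^k.
have eL : (1 - p%:M * b) * L = 1 - c * (b * L).
  have -> : c * (b * L) = p%:M * b * L - ^k * b * L by rewrite mulrBl !mulrA.
  by rewrite mulrBl mul1r {1}(geomE kb1) opprB addrA addrAC.
have eY : 1 - c * (b * L) = (1 - c * ^u) * (1 - Z * Y).
  have h : (1 - c * ^u) * (Z * Y) = c * Y.
    rewrite mulrA -(series_mull q_polys u1) [(1 - _) * _]mulrA.
    by rewrite (series_inverser q_polys u1) mul1r.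
  by rewrite [RHS]mulrBr mulr1 h mulrBr opprB addrA subrK.
rewrite !mulrA eL eY -[_ * _ * geom _]mulrA mul1B_geom // mulr1.
exact: (series_inverser q_polys u1).
Qed.

Let cZ : centered phi B (true, Z).
Proof.
split=> /=; last exact: (phi_centered_series q_polys).
exact: (centered_series_in q_polys).
Qed.

Let cY : centered phi B (false, Y).
Proof.
split=> /=.
  apply: entries_inD => //; last by apply: entries_inN => //; apply: entries_in_lift.
  apply: entries_inM => //; apply: entries_in_geom => //; apply: entries_inM => //.
  exact: entries_in_lift.
by rewrite phi_mxB phi_mx_lift // -hu subrr.
Qed.

Let zy m : seq (bool * 'M[A]_n.+1) := flatten (nseq m [:: (true, Z); (false, Y)]).

Let prod_zy m : \prod_(x <- zy m) x.2 = (Z * Y) ^+ m.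
Proof.
elim: m => [|m IH]; first by rewrite big_nil.
by rewrite /zy /= !big_cons IH exprS mulrA.
Qed.

Let path_zy m : path (fun i j => i != j) false [seq x.1 | x <- zy m].
Proof. by elim: m => //= m ->. Qed.

Let last_zy m : last false [seq x.1 | x <- zy m] = false.
Proof. by elim: m. Qed.

(** Every term of the expanded resolvent is an alternating word in the centered
    [Z] and [Y] with outer coefficients, so that only the empty word counts. *)
Lemma phi_geom_mul : phi_mx phi (geom (p%:M * b)) = 1 + k * u.
Proof.
have word s : s != [::] -> alternating [seq x.1 | x <- s] ->
    (forall x, x \in s -> x \in [:: (true, Z); (false, Y)]) ->
    phi_mx phi (\prod_(x <- s) x.2) = 0.
  move=> s0 alt hs; apply: (free_matrix_word B_free) => // x /hs.
  by rewrite !inE => /orP[] /eqP->.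
have zy_sub m x : x \in zy m -> x \in [:: (true, Z); (false, Y)].
  by move=> /flattenP[l]; rewrite mem_nseq => /andP[_ /eqP->].
have w1 m : phi_mx phi ((Z * Y) ^+ m.+1) = 0.
  rewrite -prod_zy; apply: word => //; last exact: zy_sub.
  by have /= := path_zy m.+1.
have w2 m : phi_mx phi (Y * (Z * Y) ^+ m) = 0.
  rewrite -prod_zy -(big_cons _ _ (false, Y) _ xpredT (fun x => x.2)).
  apply: word => //; first exact: path_zy.
  by move=> x; rewrite !inE => /orP[->|/zy_sub]; rewrite ?orbT // !inE.
have prod_zyZ m : \prod_(x <- rcons (zy m) (true, Z)) x.2 = (Z * Y) ^+ m * Z.
  by rewrite -cats1 big_cat big_seq1 prod_zy.
have w3 m : phi_mx phi ((Z * Y) ^+ m * Z) = 0.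
  rewrite -prod_zyZ; apply: word; first by case: (zy m).
    rewrite /alternating map_rcons.
    have : path (fun i j => i != j) false (rcons [seq x.1 | x <- zy m] true).
      by rewrite rcons_path path_zy last_zy.
    by case: [seq _ | _ <- _] => //= ? ? /andP[].
  by move=> x; rewrite mem_rcons !inE => /orP[->//|/zy_sub]; rewrite !inE.
have w4 m : phi_mx phi (Y * (Z * Y) ^+ m * Z) = 0.
  rewrite -mulrA -prod_zyZ.
  rewrite -(big_cons _ _ (false, Y) _ xpredT (fun x => x.2)).
  apply: word => //.
    by rewrite /alternating /= map_rcons rcons_path path_zy last_zy.
  by move=> x; rewrite inE mem_rcons !inE => /or3P[->|->|/zy_sub]; rewrite ?orbT // !inE.
have eL : L = ^(1 + k * u) + ^k * Y.
  rewrite lift_mxD lift_mx1 lift_mxM mulrBr [^k * (_ * _)]mulrA.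
  by rewrite -addrA (addrC (^k * ^u)) subrK -geomE.
have term m : phi_mx phi (L * (Z * Y) ^+ m * (1 + Z * ^u)) =
    (1 + k * u) * phi_mx phi ((Z * Y) ^+ m).
  rewrite {1}eL mulrDr mulr1 phi_mxD mulrA phi_mx_liftr !mulrDl -!mulrA !phi_mxD.
  by rewrite !phi_mx_liftl w3 [Y * (_ * Z)]mulrA w4 w2 !mulr0 !addr0 mul0r addr0 mulrDl -mulrA.
have geomZY : geom (Z * Y) = \sum_(m < n.+1) (Z * Y) ^+ m by [].
rewrite resolvent_factorization geomZY mulr_sumr mulr_suml.
rewrite phi_mx_sum big_ord_recl big1 => [|m _]; rewrite term ?w1 ?mulr0 //.
by rewrite expr0 -lift_mx1 phi_mx_lift // mulr1 addr0.
Qed.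

End Subordinate.
End MultiplicativeFreeness.

(** * Sums of free elements *)

Section AdditiveFreeness.
Variables (R : realType) (A : algType R[i]) (phi : {scalar A}).
Hypothesis phi1 : phi 1 = 1.
Local Notation C := R[i].
Variables (I : finType) (B : I -> set A) (a : I -> A).
Variables (kappa : I -> nat -> C) (q : I -> nat -> A).
Hypotheses (B_unital : forall l, unital_subalgebra (B l)).
Hypothesis (Ba : forall l, B l (a l)).
Hypothesis B_free : free_subalgebras phi B.
Hypothesis q_polys : forall l, cumulant_polynomials phi (a l) (kappa l) (q l).
Variable n : nat.
Variable T : I -> 'M[C]_n.+1.
Hypothesis T1 : forall l, upper 1 (T l).
Local Notation "^ D" := (lift_mx A D) (at level 8, format "^ D").
Local Notation K l y := (cumulant_series (kappa l) y).

(** The moment series [1 + v] of a sum of free elements solves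
    [1 + v = 1 + \sum_l R_l(1 + v)], where [R_l] is the cumulant series of [a l];
    here the solution is built first. *)
Lemma additive_fixpoint : exists2 v : 'M[C]_n.+1, upper 1 v &
  \sum_l K l (T l * (1 + v)) * (T l * (1 + v)) = v.
Proof.
have up1 v l : upper 1 v -> upper 1 (T l * (1 + v)).
  move=> hv; apply: upperM0 => //; apply: upperD; first exact: upper_1.
  exact: upper_le (leq0n 1) hv.
apply: upper_fixpoint => [v hv|j v w hv hw hvw].
  apply: upper_sum => l _; apply: upper0M; last exact: up1.
  exact/upper_cumulant_series/up1.
rewrite -sumrB; apply: upper_sum => l _.
have hT : upper j.+1 (T l * (1 + v) - T l * (1 + w)).
  by rewrite -mulrBr opprD addrACA subrr add0r -add1n; apply: upperM.
have lo z : upper 1 z -> upper 0 (T l * (1 + z)).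
  by move=> /up1 h; apply: upper_le (leq0n 1) (h l).
apply: upperM_congr => //; [exact/upper_cumulant_series/up1|exact: lo|].
rewrite -sumrB; apply: upper_sum => s _ i k hik.
by rewrite -scalerBr mxE (upperX_congr _ (lo _ hv) (lo _ hw) hT) ?mulr0.
Qed.

Section FixedPoint.
Variable v : 'M[C]_n.+1.
Hypotheses (v1 : upper 1 v)
  (hv : \sum_l K l (T l * (1 + v)) * (T l * (1 + v)) = v).
Local Notation y l := (T l * (1 + v)).
Local Notation Z l := (centered_series (q l) (y l)).
Local Notation c l := ((a l)%:M - ^(K l (y l))).
Local Notation X l := (Z l * ^(y l)).

Let y1 l : upper 1 (y l).
Proof.
apply: upperM0 => //; apply: upperD; first exact: upper_1.
exact: upper_le (leq0n 1) v1.
Qed.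

Let X1 l : upper 1 (X l).
Proof.
by apply: upper0M; [apply: upper_centered_series|apply: upper_lift].
Qed.

Let cX l : centered phi B (l, X l).
Proof.
split=> /=.
  apply: entries_inM => //; last exact: entries_in_lift.
  exact: (centered_series_in (q_polys l)).
by rewrite phi_mx_liftr (phi_centered_series (q_polys l)) mul0r.
Qed.

Let cy1 l : upper 1 (c l * ^(y l)).
Proof.
apply: upper0M; last exact: upper_lift.
by apply: upperB; [apply: upper_scalar|apply/upper_lift/upper_cumulant_series].
Qed.

Let G := \sum_l c l * ^(y l).
Let W := geom G.

Let G1 : upper 1 G.
Proof. exact: upper_sum. Qed.

Let Wl l := c l * ^(y l) * W.

Let WE : W = 1 + \sum_l Wl l.
Proof. by rewrite /W geomE // -/W /Wl -mulr_suml. Qed.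

(** Unfolded, this equation makes [W] the sum of all the alternating words in
    the centered elements [X], and [Wl l] of those that begin with [X l]. *)
Let WlE l : Wl l = X l * (1 + \sum_(m | m != l) Wl m).
Proof.
have -> : 1 + \sum_(m | m != l) Wl m = W - Wl l.
  by have := WE; rewrite (bigD1 l) // => {1}->; rewrite addrCA addrAC subrr add0r.
have -> : W - Wl l = (1 - c l * ^(y l)) * W by rewrite mulrBl mul1r.
have h := series_inversel (q_polys l) (y1 l).
have expand (x u w : 'M[A]_n.+1) : x * (u * w) = ((1 + x) * u - u) * w.
  by rewrite (mulrDl 1 x u) mul1r addrAC subrr add0r mulrA.
by rewrite expand h opprB addrC subrK.
Qed.

(** Each unfolding of [Wl] lengthens the centered word in front and raises its
    order, until nilpotency annihilates it. *)
Let phi_word (s : seq (I * 'M[A]_n.+1)) l d :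
  alternating (rcons [seq x.1 | x <- s] l) ->
  (forall x, x \in s -> centered phi B x) ->
  upper (n.+1 - d) (\prod_(x <- s) x.2) -> (d <= n.+1)%N ->
  phi_mx phi (\prod_(x <- s) x.2 * Wl l) = 0.
Proof.
elim: d s l => [|d IH] s l alt cs us dn.
  rewrite subn0 in us; rewrite (upper_top us) mul0r.
  by apply/matrixP => i j; rewrite !mxE linear0.
have prodE : \prod_(x <- s) x.2 * X l = \prod_(x <- rcons s (l, X l)) x.2.
  by rewrite -cats1 big_cat big_seq1.
have cs' x : x \in rcons s (l, X l) -> centered phi B x.
  by rewrite mem_rcons inE => /orP[/eqP->|/cs].
rewrite WlE mulrA mulrDr mulr1 phi_mxD prodE (free_matrix_word B_free) //; last 2 first.
- by case: (s).
- by rewrite map_rcons.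
rewrite add0r mulr_sumr phi_mx_sum big1 // => m ml; apply: IH => //; last exact: ltnW.
  rewrite map_rcons; move: alt; rewrite /alternating.
  case: [seq _ | _ <- _] => [|i t] /=; first by rewrite eq_sym ml.
  by rewrite !rcons_path last_rcons => ->; rewrite eq_sym ml.
by rewrite -prodE -subSS subSn // -addn1; apply: upperM.
Qed.

(** The choice of [v] makes [(1 - S) (1 + v)] equal to [1 - G], the inverse of
    [W], and [phi] of [W] is 1. *)
Lemma phi_geom_add : phi_mx phi (geom (\sum_l (a l)%:M * ^(T l))) = 1 + v.
Proof.
have S1 : upper 1 (\sum_l (a l)%:M * ^(T l)).
  apply: upper_sum => l _; apply: upper0M; first exact: upper_scalar.
  exact: upper_lift.
have phiW : phi_mx phi W = 1.
  rewrite WE phi_mxD -lift_mx1 phi_mx_lift // phi_mx_sum big1 ?addr0 // => l _.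
  have := @phi_word [::] l n.+1; rewrite big_nil mul1r; apply => //.
  by rewrite subnn; apply: upper_1.
rewrite -(geom_unique S1 (Y := ^(1 + v) * W)).
  by rewrite phi_mx_liftl phiW mulr1.
rewrite mulrA; transitivity ((1 - G) * W); last exact: mul1B_geom.
congr (_ * W); rewrite mulrBl mul1r -{1}hv lift_mxD lift_mx1 lift_mx_sum.
rewrite -addrA; congr (_ + _); rewrite mulr_suml -sumrB -sumrN; apply: eq_bigr => l _.
rewrite mulrBl opprB [lift_mx A (K _ _ * _)]lift_mxM.
by rewrite -[_ * _ * ^(1 + v)]mulrA -[^(T l) * _]lift_mxM.
Qed.

End FixedPoint.
End AdditiveFreeness.

(** * Moments of free Poisson elements *)

Section CatalanMoments.
Variables (R : realType) (A : algType R[i]) (phi : {scalar A}).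
Hypothesis phi1 : phi 1 = 1.
Local Notation C := R[i].
Variables (x : A) (alpha : C).

Let cm (j : nat) : C := alpha ^+ j * (catalan j)%:R.

Let cmS j : cm j.+1 = alpha * \sum_(i < j.+1) cm i * cm (j - i).
Proof.
rewrite /cm catalanS exprS -mulrA; congr (_ * _).
rewrite natr_sum mulr_sumr; apply: eq_bigr => i _.
by rewrite natrM mulrACA -exprD subnKC // -ltnS.
Qed.

(** The coefficients of the [m]-th power of the generating series of [cm]. *)
Fixpoint catalan_power (m j : nat) : C :=
  if m is m'.+1 then \sum_(i < j.+1) catalan_power m' i * cm (j - i)
  else (j == 0%N)%:R.

Let catalan_powerE m j :
  catalan_power m.+1 j = \sum_(i < j.+1) catalan_power m i * cm (j - i).
Proof. by []. Qed.

Let catalan_power0E j : catalan_power 0 j = (j == 0%N)%:R.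
Proof. by []. Qed.

Arguments catalan_power : simpl never.

Let catalan_power1 j : catalan_power 1 j = cm j.
Proof.
rewrite catalan_powerE big_ord_recl subn0 mul1r big1 ?addr0 // => i _.
by rewrite catalan_power0E mul0r.
Qed.

Let catalan_power_0 m : catalan_power m 0 = 1.
Proof.
elim: m => // m IH.
by rewrite catalan_powerE big_ord_recl big_ord0 addr0 IH /cm expr0 mul1r mul1r.
Qed.

Let catalan_powerS m j :
  catalan_power m.+1 j.+1 = catalan_power m j.+1 + alpha * catalan_power m.+2 j.
Proof.
elim: m j => [|m IH] j.
  rewrite catalan_power1 cmS catalan_power0E add0r catalan_powerE; congr (_ * _).
  by apply: eq_bigr => i _; rewrite -catalan_power1.
rewrite [LHS]catalan_powerE big_ord_recl subn0 catalan_power_0 mul1r.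
rewrite (catalan_powerE m) [in RHS]big_ord_recl subn0 catalan_power_0 mul1r.
rewrite -addrA; congr (_ + _).
rewrite [X in alpha * X]catalan_powerE mulr_sumr -big_split /=.
apply: eq_bigr => i _; rewrite (_ : bump 0 i = i.+1) // subSS mulrA -mulrDl; congr (_ * _).
exact: IH.
Qed.

(** The value of [phi (x ^+ j * q m)] for the free Poisson law of rate 1. *)
Let mixed_moment m j : C :=
  if m is 0 then catalan_power 1 j
  else alpha ^+ m * (catalan_power m.+1 j - catalan_power m j).

Let mixed_momentE m j : mixed_moment m.+1 j =
  alpha ^+ m.+1 * (catalan_power m.+2 j - catalan_power m.+1 j).
Proof. by []. Qed.

Let mixed_moment_sum m j :
  \sum_(s < m.+1) alpha ^+ s.+1 * mixed_moment (m - s) j =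
  alpha ^+ m.+1 * catalan_power m.+1 j.
Proof.
elim: m => [|m IH]; first by rewrite big_ord1.
rewrite big_ord_recl subn0.
under eq_bigr => s _ do rewrite !lift0 subSS exprS -mulrA.
rewrite -mulr_sumr IH mixed_momentE expr1 -mulrDr [in RHS]exprS -mulrA.
by congr (_ * _); rewrite mulrBr subrK.
Qed.

Let mixed_moment_rec m j : mixed_moment m j.+1 =
  mixed_moment m.+1 j + \sum_(s < m.+1) alpha ^+ s.+1 * mixed_moment (m - s) j.
Proof.
rewrite mixed_moment_sum [mixed_moment m.+1 j]mixed_momentE -mulrDr subrK.
case: m => [|m].
  by rewrite [LHS]catalan_powerS expr1 [catalan_power 0 _]/= add0r.
by rewrite mixed_momentE catalan_powerS addrC addKr mulrA -exprSr.
Qed.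

Variable q : nat -> A.
Hypotheses (q0 : q 0%N = 1)
  (qS : forall m, x * q m = q m.+1 + \sum_(s < m.+1) alpha ^+ s.+1 *: q (m - s)%N).

Let phi_qS m j : phi (x ^+ j.+1 * q m) =
  phi (x ^+ j * q m.+1) + \sum_(s < m.+1) alpha ^+ s.+1 * phi (x ^+ j * q (m - s)%N).
Proof.
rewrite exprSr -mulrA qS mulrDr mulr_sumr raddfD raddf_sum /=; congr (_ + _).
by apply: eq_bigr => s _; rewrite -scalerAr linearZ.
Qed.

(** The numbers [phi (x ^+ j * q m)] obey a recursion that determines them from
    their values at [j = 0], and also from their values at [m = 0]; the numbers
    [mixed_moment m j] obey the same recursion. *)
Lemma catalan_momentsP :
  (forall m, phi (q m.+1) = 0) <->
  (forall j, phi (x ^+ j) = alpha ^+ j * (catalan j)%:R).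
Proof.
split=> [qc j|mom m].
  suff gen m : phi (x ^+ j * q m) = mixed_moment m j.
    by have := gen 0%N; rewrite q0 mulr1 => ->; rewrite /mixed_moment catalan_power1.
  elim: j m => [|j IH] m.
    rewrite mul1r; case: m => [|m]; first by rewrite q0 phi1 [RHS]catalan_power_0.
    by rewrite qc mixed_momentE !catalan_power_0 subrr mulr0.
  rewrite phi_qS mixed_moment_rec IH; congr (_ + _).
  by apply: eq_bigr => s _; rewrite IH.
suff gen j : phi (x ^+ j * q m.+1) = mixed_moment m.+1 j.
  have := gen 0%N; rewrite mul1r => ->.
  by rewrite mixed_momentE !catalan_power_0 subrr mulr0.
elim/ltn_ind: {m}m.+1 j => -[_ j|m IH j].
  by rewrite q0 mulr1 mom [RHS]catalan_power1.
have := mixed_moment_rec m j; rewrite -IH // phi_qS.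
under eq_bigr => s _ do rewrite IH ?ltnS ?leq_subr //.
by move/addIr.
Qed.

End CatalanMoments.

Section PoissonMoments.
Variables (R : realType) (A : algType R[i]) (phi : {scalar A}).
Hypothesis phi1 : phi 1 = 1.
Local Notation C := R[i].
Variables (x : A) (alpha : C).

Let prod_blocks n (P : {set {set 'I_n}}) : P \in NC n ->
  \prod_(V in P) alpha ^+ #|V| = alpha ^+ n.
Proof.
rewrite inE => /andP[hP _].
by rewrite prodrXr -(finset.card_partition hP) cardsT card_ord.
Qed.

(** If the cumulant of order [n] is [alpha ^+ n], every noncrossing partition
    contributes [alpha ^+ n] to the moment of order [n]. *)
Lemma poisson_momentsP :
  (forall n, (1 <= n)%N -> free_cumulant phi (fun _ : 'I_n => x) = alpha ^+ n) <->
  (forall n, phi (x ^+ n) = alpha ^+ n * (catalan n)%:R).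
Proof.
split=> [cum [|n]|mom]; first by rewrite phi1 mul1r.
  have := free_cumulant_moment phi (fun _ : 'I_n.+1 => x) (ltn0Sn n).
  rewrite prodr_const card_ord => ->.
  rewrite -card_NC -sum1_card natr_sum mulr_sumr.
  apply: eq_bigr => P hP; rewrite mulr1 -(prod_blocks hP); apply: eq_bigr => V hV.
  by rewrite cum //; apply: NC_block_card hV.
elim/ltn_ind => n IH n1; rewrite free_cumulantE // prodr_const card_ord mom.
rewrite (eq_bigr (fun=> alpha ^+ n)) => [|P /andP[hP hne]]; last first.
  rewrite -(prod_blocks hP); apply: eq_bigr => V hV.
  by apply: IH; [exact: NC_block_lt hV|exact: NC_block_card hV].
have -> : alpha ^+ n * (catalan n)%:R = \sum_(P in NC n) alpha ^+ n.
  rewrite -card_NC -sum1_card natr_sum mulr_sumr.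
  by apply: eq_bigr => P _; rewrite mulr1.
by rewrite (bigD1 [set [set: 'I_n]]%SET) ?noncrossing_setT //= addrK.
Qed.

End PoissonMoments.

(** * Words as matrices *)

Section ShiftMatrices.
Variables (R : realType) (A : algType R[i]) (phi : {scalar A}).
Local Notation C := R[i].
Variable n : nat.
Local Notation "^ D" := (lift_mx A D) (at level 8, format "^ D").

Lemma geom_mulC (S : nzRingType) (X Y : 'M[S]_n.+1) :
  geom (X * Y) * X = X * geom (Y * X).
Proof.
rewrite mulr_suml mulr_sumr; apply: eq_bigr => s _.
elim: (s : nat) => [|m IH]; first by rewrite mul1r mulr1.
by rewrite !exprS -[LHS]mulrA IH !mulrA.
Qed.

Lemma geom_diag (S : nzRingType) (X : 'M[S]_n.+1) i : upper 1 X -> geom X i i = 1.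
Proof.
move=> hX; rewrite geomE // mxE [in X in X + _]mxE eqxx.
rewrite (_ : (X * _) i i = 0) ?addr0 //; apply: (upperM0 hX); last by rewrite addn1.
by apply: upper_geom; apply: upper_le (leq0n 1) hX.
Qed.

Lemma scalar_lift_entry (x : A) (D : 'M[C]_n.+1) i j :
  (x%:M * ^D) i j = D i j *: x.
Proof.
rewrite mxE (bigD1 i) //= big1 => [|c ci]; last first.
  by rewrite !mxE eq_sym (negbTE ci) mul0r.
by rewrite addr0 !mxE eqxx mulr1n /= mulr_algr.
Qed.

(** The word [x 0, x 1, ..., x n.-1] as a series of degree one. *)
Definition shift_mx (x : nat -> A) : 'M[A]_n.+1 :=
  \matrix_(i, j) if j == i.+1 :> nat then x i else 0.

Lemma upper_shift x : upper 1 (shift_mx x).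
Proof. by move=> i j; rewrite addn1 mxE => hj; case: eqP => // e; rewrite e ltnn in hj. Qed.

Lemma shift_mx_in (B : set A) x : unital_subalgebra B -> (forall j, B (x j)) ->
  entries_in B (shift_mx x).
Proof. by move=> hB hx i j; rewrite mxE; case: eqP => // _; apply: subalgebra0. Qed.

Lemma scalar_shift (y : A) x : y%:M * shift_mx x = shift_mx (fun j => y * x j).
Proof.
apply/matrixP => i j; rewrite mxE (bigD1 i) //= big1 => [|c ci]; last first.
  by rewrite !mxE eq_sym (negbTE ci) mul0r.
by rewrite addr0 !mxE eqxx mulr1n; case: eqP => // _; rewrite mulr0.
Qed.

Lemma shift_mul x (E : 'M[A]_n.+1) (i j : 'I_n.+1) :
  (shift_mx x * E) i j = if (i < n)%N then x i * E (inord i.+1) j else 0.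
Proof.
rewrite mxE; case: ltnP => hi.
  rewrite (bigD1 (inord i.+1)) //= big1 => [|c ci]; last first.
    rewrite mxE; case: eqP => [e|]; rewrite ?mul0r //.
    by case/eqP: ci; apply: val_inj; rewrite /= inordK // -e.
  by rewrite addr0 mxE inordK // eqxx.
rewrite big1 // => c _; rewrite mxE; case: eqP => [e|]; rewrite ?mul0r //.
by move: (ltn_ord c); rewrite e ltnS ltnNge hi.
Qed.

Lemma geom_shift x (D : 'M[A]_n.+1) (i j : 'I_n.+1) : upper 0 D ->
  geom (shift_mx x * D) i j = (i == j)%:R +
    if (i < n)%N then x i * (D * geom (shift_mx x * D)) (inord i.+1) j else 0.
Proof.
move=> hD; rewrite {1}geomE; last by apply: upperM0 => //; apply: upper_shift.
by rewrite mxE [X in X + _]mxE -mulrA shift_mul.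
Qed.

Section Letters.
Variables (k : nat) (b : 'I_k -> A) (w : nat -> 'I_k).

(** The places of the letter [l] in the word [w]: the coefficient of [b l] in
    the series of the word in the [b l]. *)
Definition letter_mx (l : 'I_k) : 'M[C]_n.+1 :=
  \matrix_(i, j) ((j == i.+1 :> nat) && (w i == l))%:R.

Lemma upper_letter l : upper 1 (letter_mx l).
Proof. by move=> i j; rewrite addn1 mxE => hj; case: eqP => // e; rewrite e ltnn in hj. Qed.

Lemma shift_letters :
  shift_mx (fun j => b (w j)) = \sum_l (b l)%:M * ^(letter_mx l).
Proof.
apply/matrixP => i j; rewrite summxE (bigD1 (w i)) //= big1 => [|l lw]; last first.
  by rewrite scalar_lift_entry mxE [w i == l]eq_sym (negbTE lw) andbF scale0r.
by rewrite scalar_lift_entry !mxE eqxx andbT addr0; case: eqP; rewrite ?scale1r ?scale0r.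
Qed.

(** The power is expanded along all the words [f] of length [s], because the
    elements [b l] do not commute. *)
Lemma phi_shift_power (D : 'M[C]_n.+1) s :
  phi_mx phi ((shift_mx (fun j => b (w j)) * ^D) ^+ s) =
  \sum_(f : {ffun 'I_s -> 'I_k})
     phi (\prod_j b (f j)) *: \prod_j (letter_mx (f j) * D).
Proof.
rewrite -[s in _ ^+ s]card_ord -prodr_const shift_letters mulr_suml.
rewrite (eq_bigl xpredT) // bigA_distr_bigA phi_mx_sum; apply: eq_bigr => f _.
rewrite -phi_mx_scalar_lift; congr phi_mx.
elim/big_rec3: _ => [|j E y X _ ->]; first by rewrite lift_mx1 mulr1.
rewrite -mul_scalars [in RHS]lift_mxM -[_ * ^(letter_mx _) * ^D]mulrA -lift_mxM.
rewrite -[LHS]mulrA -[RHS]mulrA; congr ((b (f j))%:M * _).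
by rewrite !mulrA lift_comm.
Qed.

Lemma letters_entry (D : 'M[C]_n.+1) (v : seq 'I_k) (i j : 'I_n.+1) :
  upper 0 D -> (forall i, D i i = 1) -> j = (i + size v)%N :> nat ->
  (\prod_(l <- v) (letter_mx l * D)) i j =
  (v == [seq w m | m <- iota i (size v)])%:R.
Proof.
move=> D0 D1; elim: v i => [|l v IH] i /=.
  by rewrite addn0 big_nil => hj; rewrite mxE (val_inj hj : j = i) eqxx.
move=> hj; rewrite big_cons.
have E1 m : upper 1 (letter_mx m * D) by apply: upperM0 => //; apply: upper_letter.
have hi : (i.+1 < n.+1)%N by rewrite (leq_trans _ (ltn_ord j)) // hj addnS !ltnS leq_addr.
have Ev : upper (size v) (\prod_(m <- v) (letter_mx m * D)).
  elim: (v) => [|m v' IHv]; first by rewrite big_nil; exact: upper_1.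
  by rewrite big_cons /= -add1n; apply: upperM.
rewrite (upperM_entry (c := Ordinal hi) (E1 l) Ev) /= ?addn1 //; last first.
  by rewrite hj addnS addSn.
rewrite IH /= ?hj ?addnS // (upperM_entry (c := Ordinal hi) (@upper_letter l) D0) /=;
  rewrite ?addn1 ?addn0 //.
by rewrite D1 mulr1 mxE /= eqxx /= -natrM mulnb eqseq_cons [l == _]eq_sym.
Qed.

(** The top right entry picks out one word, [w] itself. *)
Lemma letters_top_entry (D : 'M[C]_n.+1) (f : {ffun 'I_n -> 'I_k}) :
  upper 0 D -> (forall i, D i i = 1) ->
  (\prod_j (letter_mx (f j) * D)) ord0 ord_max = (f == [ffun j : 'I_n => w j])%:R.
Proof.
move=> D0 D1.
have -> : \prod_j (letter_mx (f j) * D) =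
    \prod_(l <- [seq f j | j <- enum 'I_n]) (letter_mx l * D).
  by rewrite big_map [index_enum _]unlock enumT.
have sz : size [seq f j | j <- enum 'I_n] = n by rewrite size_map size_enum_ord.
rewrite letters_entry //= ?sz ?add0n // -val_enum_ord -map_comp; congr (nat_of_bool _)%:R.
apply/eqP/eqP => [e|->]; last by apply: eq_map => j /=; rewrite ffunE.
apply/ffunP => j; rewrite ffunE; have /eq_in_map := e.
by move=> /(_ j (mem_enum _ _)).
Qed.

End Letters.
End ShiftMatrices.

(** * From a free Poisson element to vanishing mixed moments *)

Section FreePair.
Variables (R : realType) (A : algType R[i]) (phi : {scalar A}).
Hypothesis phi1 : phi 1 = 1.
Local Notation C := R[i].
Local Notation "^ D" := (lift_mx A D) (at level 8, format "^ D").

Lemma phi_geom_mulr n (kappa : nat -> C) (x : 'M[A]_n.+1) (u : 'M[C]_n.+1) :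
  upper 1 x -> upper 1 u -> subordinate phi kappa x u ->
  phi_mx phi (geom (x * ^(cumulant_series kappa u))) =
  1 + cumulant_series kappa u * u.
Proof.
move=> x1 u1 hu; set K := cumulant_series kappa u.
have xK1 : upper 1 (x * ^K).
  by apply: upperM0 => //; apply/upper_lift/upper_cumulant_series.
rewrite geomE // -mulrA -geom_mulC mulrA phi_mxD phi_mx_liftr -hu.
by rewrite -lift_mx1 phi_mx_lift // cumulant_series_comm.
Qed.

Variables (k : nat) (p : A) (b : 'I_k -> A).
Hypothesis p_b_free : free_pair phi [set p] (range b).

Let B (c : bool) : set A := generated_subalgebra (if c then [set p] else range b).

Let B_unital c : unital_subalgebra (B c).
Proof. exact: generated_subalgebra_unital. Qed.

Let Bp : B true p.
Proof. exact: generated_subalgebra_mem. Qed.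

Let Bb l : B false (b l).
Proof. by apply: generated_subalgebra_mem; exists l. Qed.

(** The second expression of [M] comes from the first one by multiplying the
    equation of [u] by [K]: it exhibits the moments of the words in the [b l] as
    coefficients of an expansion of [M] in the words in [K]. *)
Lemma free_pair_moments n (w : nat -> 'I_k) kappa q :
  cumulant_polynomials phi p kappa q ->
  let x := @shift_mx R A n (fun j => b (w j)) in
  let M := phi_mx phi (geom (p%:M * x)) in
  exists u : 'M[C]_n.+1, let K := cumulant_series kappa u in
    [/\ upper 1 u, u = phi_mx phi (x * geom (^K * x)), M = 1 + K * u &
        M = phi_mx phi (geom (x * ^K))].
Proof.
move=> q_polys x M.
have x1 : upper 1 x by apply: upper_shift.
have Bx : entries_in (B false) x by apply: shift_mx_in.
have [u u1 hu] := subordinate_exists phi kappa x1.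
have MK := phi_geom_mul phi1 B_unital Bp p_b_free q_polys x1 Bx u1 hu.
by exists u; split=> //; rewrite [LHS]MK phi_geom_mulr.
Qed.

(** The geometric series: for rate 1, the equation [M = 1 + K u] becomes
    [K = alpha M]. *)
Lemma poisson_series n (alpha : C) (u : 'M[C]_n.+1) : upper 1 u ->
  let K := cumulant_series (fun s => alpha ^+ s.+1) u in K = alpha *: (1 + K * u).
Proof.
move=> u1 K; rewrite {1}/K /cumulant_series big_ord_recl expr1 expr0 scalerDr.
congr (_ + _); rewrite /K /cumulant_series big_ord_recr /= mulrDl -scalerAl -exprSr.
rewrite upper_nilpotent // scaler0 addr0 mulr_suml scaler_sumr.
by apply: eq_bigr => s _; rewrite -scalerAl scalerA -exprSr -exprS.
Qed.

Section PoissonWords.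
Hypothesis pb_free : free_elements phi (fun l => p * b l).
Variable alpha : C.
Hypothesis alpha0 : alpha != 0.
Hypothesis p_moments : forall n, phi (p ^+ n) = alpha ^+ n * (catalan n)%:R.

Variables (kappa : 'I_k -> nat -> C) (q : 'I_k -> nat -> A).
Hypothesis q_polys : forall l, cumulant_polynomials phi (p * b l) (kappa l) (q l).

Let power_letters n (w : nat -> 'I_k) (D : 'M[C]_n.+1) s :
  \sum_l kappa l s *: (letter_mx R n w l * D) ^+ s.+1 =
  \sum_(f : {ffun 'I_s.+1 -> 'I_k}) (\sum_(l | f == [ffun=> l]) kappa l s) *:
     \prod_j (letter_mx R n w (f j) * D).
Proof.
under [RHS]eq_bigr => f _ do rewrite scaler_suml.
rewrite (exchange_big_dep xpredT) //=; apply: eq_bigr => l _.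
rewrite big_pred1_eq; congr (_ *: _).
by under eq_bigr => j _ do rewrite ffunE; rewrite prodr_const card_ord.
Qed.

(** The moment series [M] of the [p * b l] is [1 + phi (b K + b K b K + ...)] with
    [K = alpha M] because [p] is Poisson, and [1 + \sum_l R_l(M)] because the
    [p * b l] are free.  Expanded along words, the two series have coefficients
    that must agree one word at a time: shorter words by induction, and the
    word [f] in the top right entry. *)
Lemma poisson_word_cumulants s (f : {ffun 'I_s.+1 -> 'I_k}) :
  alpha ^+ s.+1 * phi (\prod_j b (f j)) = \sum_(l | f == [ffun=> l]) kappa l s.
Proof.
elim/ltn_ind: s f => s IH f.
pose w (j : nat) : 'I_k := f (inord j).
have [r r0 rS] := cumulant_recursion p (fun j _ => alpha ^+ j.+1).
have r_polys : cumulant_polynomials phi p (fun j => alpha ^+ j.+1) r.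
  by split=> //; apply/(catalan_momentsP phi1 r0 rS).
have [u [u1 hu MKu MK]] := free_pair_moments s.+1 w r_polys.
set x := shift_mx _ _ in hu MKu MK; set M := phi_mx phi (geom (_ * x)) in MKu MK.
set K := cumulant_series _ u in hu MKu MK.
have KE : K = alpha *: M by rewrite MKu; apply: poisson_series.
pose T l := letter_mx R s.+1 w l.
have T1 l : upper 1 (T l) by apply: upper_letter.
have [v v1 hv] := additive_fixpoint kappa T1.
pose Bl l := generated_subalgebra [set p * b l].
have MT : M = 1 + v.
  rewrite /M scalar_shift (shift_letters _ (fun l => p * b l) w).
  apply: (phi_geom_add (B := Bl) phi1 _ _ _ q_polys T1 v1 hv) => // l.
    exact: generated_subalgebra_unital.
  exact: generated_subalgebra_mem.
have M0 : upper 0 M.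
  by rewrite MT; apply: upperD; [exact: upper_1|exact: upper_le (leq0n 1) v1].
have M1 j : M j j = 1.
  by rewrite MT mxE [v j j]v1 ?addr0 ?mxE ?eqxx // addn1.
pose P m (g : {ffun 'I_m.+1 -> 'I_k}) := \prod_j (T (g j) * M).
pose L m := \sum_(g : {ffun 'I_m.+1 -> 'I_k})
    (alpha ^+ m.+1 * phi (\prod_j b (g j))) *: P m g.
pose Q m := \sum_(g : {ffun 'I_m.+1 -> 'I_k})
    (\sum_(l | g == [ffun=> l]) kappa l m) *: P m g.
have lhs : M = 1 + \sum_(m < s.+1) L m.
  rewrite {1}MK /geom phi_mx_sum big_ord_recl expr0 -lift_mx1 phi_mx_lift //.
  congr (_ + _); apply: eq_bigr => m _; rewrite phi_shift_power.
  apply: eq_bigr => g _; rewrite [_ * phi _]mulrC -[RHS]scalerA; congr (_ *: _).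
  rewrite /P -[m.+1 in X in _ ^+ X]card_ord -prodr_const -scaler_prod.
  by apply: eq_bigr => j _; rewrite KE -scalerAr.
have rhs : M = 1 + \sum_(m < s.+1) Q m.
  rewrite {1}MT -{1}hv -MT; congr (_ + _).
  rewrite -(eq_bigr _ (fun (m : 'I_s.+1) _ => power_letters w M m)) exchange_big /=.
  apply: eq_bigr => l _; rewrite mulr_suml big_ord_recr /= -scalerAl -exprSr.
  rewrite upper_nilpotent ?scaler0 ?addr0; last exact: upperM0.
  by apply: eq_bigr => m _; rewrite -scalerAl -exprSr.
have LQ m : (m < s)%N -> L m = Q m.
  by move=> ms; apply: eq_bigr => g _; rewrite IH.
have : L s = Q s.
  have := lhs; rewrite {1}rhs => /addrI; rewrite !big_ord_recr /=.
  by under eq_bigr => m _ do rewrite -LQ //; move/addrI.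
move=> /matrixP/(_ ord0 ord_max).
have wf : f = [ffun j : 'I_s.+1 => w j].
  by apply/ffunP => j; rewrite ffunE /w inord_val.
have top g : P s g ord0 ord_max = (g == f)%:R.
  by rewrite wf /P letters_top_entry.
have entry c : (\sum_g c g *: P s g) ord0 ord_max = c f.
  rewrite summxE (bigD1 f) //= big1 => [|g gf]; last first.
    by rewrite mxE top (negbTE gf) mulr0.
  by rewrite mxE top eqxx mulr1 addr0.
by rewrite /L /Q !entry.
Qed.

End PoissonWords.

(** Moments of the [b l] are, up to powers of [alpha], cumulants of the free
    elements [p * b l], and a nonconstant word is a mixed one. *)
Lemma poisson_mixed_moments (alpha : C) (s : seq 'I_k) :
  free_elements phi (fun l => p * b l) -> alpha != 0 ->
  (forall n, phi (p ^+ n) = alpha ^+ n * (catalan n)%:R) ->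
  ~~ constant s -> phi (\prod_(l <- s) b l) = 0.
Proof.
move=> pb_free alpha0 mom.
have ex l : exists d : (nat -> C) * (nat -> A),
    cumulant_polynomials phi (p * b l) d.1 d.2.
  by have [c [r h]] := cumulant_polynomials_exist phi1 (p * b l); exists (c, r).
have [d hd] := choice ex.
case: s => // l0 s ns; rewrite big_tnth.
pose f := [ffun j : 'I_(size s).+1 => tnth (in_tuple (l0 :: s)) j].
have := poisson_word_cumulants pb_free mom hd f.
under eq_bigr => j _ do rewrite ffunE.
rewrite [in X in _ = X]big_pred0 => [/eqP|l].
  by rewrite mulf_eq0 expf_eq0 (negbTE alpha0) andbF /= => /eqP.
apply/eqP => fl; case/negP: ns; rewrite /=.
have all_l j : (j < (size s).+1)%N -> nth l0 (l0 :: s) j = l.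
  move=> hj; have := congr1 (fun g : {ffun _ -> _} => g (Ordinal hj)) fl.
  by rewrite !ffunE (tnth_nth l0).
apply/(all_nthP l0) => j hj /=; have := all_l j.+1 hj => /= ->.
by have /= -> := all_l 0%N isT.
Qed.

End FreePair.

(** * From a free categorical tuple to free Poisson cumulants *)

Section FreeProducts.
Variables (R : realType) (A : algType R[i]) (phi : {scalar A}).
Hypothesis phi1 : phi 1 = 1.
Local Notation C := R[i].
Local Notation "^ D" := (lift_mx A D) (at level 8, format "^ D").

Lemma free_mul (I : eqType) (B : I -> set A) i j x y :
  (forall l, unital_subalgebra (B l)) -> free_subalgebras phi B -> i != j ->
  B i x -> B j y -> phi (x * y) = phi x * phi y.
Proof.
move=> hB B_free ij Bx By.
have center l z : B l z -> B l (z - (phi z)%:A) /\ phi (z - (phi z)%:A) = 0.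
  have [h1 hD hZ _] := hB l => Bz; split.
    by apply: hD => //; apply: subalgebraN => //; apply: hZ.
  by rewrite linearB linearZ /= phi1 mulr1 subrr.
have [hx x0] := center _ _ Bx; have [hy y0] := center _ _ By.
have := free_word B_free (s := [:: (i, x - (phi x)%:A); (j, y - (phi y)%:A)]) isT.
rewrite /alternating /= ij big_cons big_seq1 /= => /(_ isT).
have h z : z \in [:: (i, x - (phi x)%:A); (j, y - (phi y)%:A)] ->
    B z.1 z.2 /\ phi z.2 = 0.
  by rewrite !inE => /orP[] /eqP->.
move=> /(_ h); rewrite mulrBr linearB mulr_algr [X in _ - X]linearZ /= x0 mulr0 subr0.
by rewrite mulrBl linearB mulr_algl [X in _ - X]linearZ /= => /subr0_eq.
Qed.

Lemma lift_mul_entry n (D : 'M[C]_n.+1) (X : 'M[A]_n.+1) i j :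
  (^D * X) i j = \sum_l D i l *: X l j.
Proof. by rewrite mxE; apply: eq_bigr => l _; rewrite mxE /= mulr_algl. Qed.

Lemma upper_power_entry n (u : 'M[C]_n.+1) (a : C) r (c d : 'I_n.+1) :
  upper 1 u -> (forall e f : 'I_n.+1, (0 < e)%N -> f = e.+1 :> nat -> u e f = a) ->
  (0 < c)%N -> d = (c + r)%N :> nat -> (u ^+ r) c d = a ^+ r.
Proof.
move=> u1 hu; elim: r c => [|r IH] c c0 hd.
  by rewrite addn0 in hd; rewrite !expr0 mxE (val_inj hd : d = c) eqxx.
have hc : (c.+1 < n.+1)%N by rewrite (leq_trans _ (ltn_ord d)) // hd addnS !ltnS leq_addr.
rewrite !exprS (upperM_entry (c := Ordinal hc) u1 (upperX u1)) /= ?addn1 //;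
  last by rewrite hd addnS addSn.
by rewrite (hu c (Ordinal hc)) // IH //= hd addnS addSn.
Qed.

Section CategoricalCumulants.
Variables (k : nat) (p : A) (b : 'I_k -> A) (i m : 'I_k).
Hypothesis p_b_free : free_pair phi [set p] (range b).
Hypothesis pb_free : free_elements phi (fun l => p * b l).
Hypothesis im : i != m.
Hypothesis b_mixed : forall r, phi (b m * b i ^+ r.+1) = 0.
Hypotheses (bi0 : phi (b i) != 0) (bm0 : phi (b m) != 0).
Variables (kappa : nat -> C) (q : nat -> A).
Hypothesis q_polys : cumulant_polynomials phi p kappa q.

(* The word is m followed by n letters i. *)
Section Words.
Variable n : nat.
Let w (j : nat) : 'I_k := if j is 0 then m else i.
Let x := shift_mx n.+1 (fun j => b (w j)).
Let M := phi_mx phi (geom (p%:M * x)).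
Let o1 : 'I_n.+2 := inord 1.

Let wi j : (0 < j)%N -> w j = i.
Proof. by case: j. Qed.

(** A word that begins with [b m] and continues with [b i] only has moment 0. *)
Let phi_after_bm (D : 'M[C]_n.+2) (c d : 'I_n.+2) : upper 0 D -> (0 < c)%N ->
  phi (b m * geom (x * ^D) c d) = (c == d)%:R * phi (b m).
Proof.
move=> D0; set G := geom _.
have step r (e : 'I_n.+2) : (0 < e)%N ->
    (forall f : 'I_n.+2, (e < f)%N -> phi (b m * b i ^+ r.+1 * G f d) = 0) ->
    phi (b m * b i ^+ r * G e d) = (e == d)%:R * phi (b m * b i ^+ r).
  move=> e0 IH; rewrite /G geom_shift; last exact: upper_lift.
  rewrite mulrDr linearD /=; case: ltnP => he; last first.
    by rewrite mulr0 linear0 addr0 mulr_natr linearMn mulr_natl.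
  rewrite wi // lift_mul_entry mulrA !mulr_sumr linear_sum big1 ?addr0 => [|f _].
    by rewrite mulr_natr linearMn mulr_natl.
  rewrite -scalerAr linearZ /= -mulrA -exprSr.
  have [ef|fe] := ltnP e f; first by rewrite IH ?mulr0.
  by rewrite D0 ?mul0r // addn0 inordK.
have zero r (e : 'I_n.+2) : (0 < e)%N -> phi (b m * b i ^+ r.+1 * G e d) = 0.
  have [h] := ubnP (n.+2 - e)%N; elim: h r e => // h IH r e he e0.
  rewrite step // ?b_mixed ?mulr0 // => f ef; apply: IH; last exact: ltn_trans ef.
  by rewrite ltnS in he; apply: leq_trans he; rewrite ltn_sub2l.
move=> c0; have := step 0%N c c0 (fun f ef => zero 0%N f (ltn_trans c0 ef)).
by rewrite !expr0 !mulr1.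
Qed.

(** The first row of [x] holds [b m] only, and what follows it is evaluated by
    [phi_after_bm]. *)
Let first_row (u : 'M[C]_n.+2) : let K := cumulant_series kappa u in
  upper 1 u -> M = phi_mx phi (geom (x * ^K)) ->
  M ord0 ord_max = phi (b m) * K o1 ord_max.
Proof.
move=> K u1 ->; have K0 : upper 0 K by apply: upper_cumulant_series.
rewrite mxE geom_shift; last exact: upper_lift.
rewrite /= add0r lift_mul_entry mulr_sumr linear_sum (bigD1 ord_max) //= big1.
  rewrite addr0 -scalerAr linearZ /= phi_after_bm // eqxx mul1r mulrC.
  by [].
move=> f fmax; rewrite -scalerAr linearZ /=.
have [f0|f0] := posnP f; first by rewrite K0 ?mul0r // addn0 inordK // f0.
by rewrite phi_after_bm // (negbTE fmax) mul0r mulr0.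
Qed.

(** What follows the first letter lies in the algebra generated by [p * b i],
    which is free from [p * b m]. *)
Let first_row_free : M ord0 ord_max = phi p * phi (b m) * M o1 ord_max.
Proof.
pose Bl l := generated_subalgebra [set p * b l].
have Bu l : unital_subalgebra (Bl l) by apply: generated_subalgebra_unital.
have Ba l : Bl l (p * b l) by apply: generated_subalgebra_mem.
pose G := geom (shift_mx n.+1 (fun j => p * b (w j))).
have row c d : G c d = (c == d)%:R +
    if (c < n.+1)%N then p * b (w c) * G (inord c.+1) d else 0.
  have := @geom_shift R A n.+1 (fun j => p * b (w j)) 1 c d (@upper_1 _ _).
  by rewrite mulr1 mul1r.
have GB (c d : 'I_n.+2) : (0 < c)%N -> Bl i (G c d).
  have [h1 hD hZ hM] := Bu i.
  have Bn (t : bool) : Bl i t%:R by case: t => //; apply: subalgebra0.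
  have [h] := ubnP (n.+2 - c)%N; elim: h c => // h IH c hc c0; rewrite row.
  apply: hD => //; case: ltnP => hn; last exact: subalgebra0.
  rewrite wi //; apply: hM => //; apply: IH; rewrite inordK //.
  by rewrite ltnS in hc; apply: leq_trans hc; rewrite ltn_sub2l.
rewrite /M scalar_shift mxE [phi_mx _ _ _ _]mxE -/G row /= add0r.
rewrite (free_mul (j := i) Bu pb_free _ (Ba m)); first last.
- by apply: GB; rewrite inordK.
- by rewrite eq_sym.
congr (_ * _).
apply: (free_mul (i := true) (j := false) _ p_b_free) => //.
- by move=> c; apply: generated_subalgebra_unital.
- exact: generated_subalgebra_mem.
- by apply: generated_subalgebra_mem; exists m.
Qed.

(** The two evaluations of the moment of the word [m i ... i] give [K = alpha M]
    in one entry, where [M = 1 + K u].  The geometric series [P] satisfies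
    [P = alpha (1 + P u)]; by induction [K] and [P] differ first in degree [n],
    and in that entry the coefficient of degree [n] is multiplied by the nonzero
    number [phi (b i) ^+ n]. *)
Lemma categorical_cumulant_step : (0 < n)%N ->
  (forall s, (s < n)%N -> kappa s = phi p ^+ s.+1) -> kappa n = phi p ^+ n.+1.
Proof.
move=> n0 IH; set alpha := phi p.
have [u [u1 hu MKu MK]] := free_pair_moments phi1 p_b_free n.+1 w q_polys.
set K := cumulant_series kappa u in hu MKu MK.
have {}MKu : M = 1 + K * u by [].
have eK : K o1 ord_max = alpha * M o1 ord_max.
  apply: (mulfI bm0); rewrite -(first_row u1 MK) first_row_free.
  by rewrite mulrCA mulrA.
pose P := cumulant_series (fun s => alpha ^+ s.+1) u.
have PE : P = alpha *: (1 + P * u) by apply: poisson_series.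
pose D := K - P.
have DE : D = \sum_(s < n.+2) (kappa s - alpha ^+ s.+1) *: u ^+ s.
  by rewrite /D -sumrB; apply: eq_bigr => s _; rewrite scalerBl.
have {}DE : D = (kappa n - alpha ^+ n.+1) *: u ^+ n +
    (kappa n.+1 - alpha ^+ n.+2) *: u ^+ n.+1.
  rewrite DE !big_ord_recr big1 => [|s _]; first by rewrite /= add0r.
  by rewrite /= IH // subrr scale0r.
have un1 : (u ^+ n.+1) o1 ord_max = 0.
  by apply: (upperX (k := n.+1) u1); rewrite inordK.
have un : (u ^+ n) o1 ord_max = phi (b i) ^+ n.
  apply: (upper_power_entry u1); rewrite ?inordK ?add1n // => e f e0 hf.
  rewrite hu mxE shift_mul -ltnS -hf ltn_ord inord_val.
  rewrite geom_diag ?mulr1 ?wi //; apply: upper0M; last exact: upper_shift.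
  exact/upper_lift/upper_cumulant_series.
have Du : (D * u) o1 ord_max = 0.
  rewrite DE mulrDl -!scalerAl -!exprSr mxE [X in X + _]mxE [X in _ + X]mxE un1.
  by rewrite upper_nilpotent // mxE !mulr0 addr0.
have D1 : D o1 ord_max = 0.
  transitivity ((K - alpha *: M) o1 ord_max); last first.
    by rewrite mxE [X in _ + X]mxE [X in _ - X]mxE eK subrr.
  rewrite MKu -[K in 1 + K * _](subrK P) -/D mulrDl addrCA scalerDr -PE.
  by rewrite opprD addrCA -/D [RHS]mxE [X in X + _]mxE [X in - X]mxE Du mulr0 oppr0 add0r.
move: D1; rewrite DE mxE [X in X + _]mxE [X in _ + X]mxE un un1 mulr0 addr0.
move/eqP; rewrite mulf_eq0 expf_eq0 (negbTE bi0) andbF orbF subr_eq0.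
by move/eqP.
Qed.

End Words.

Lemma categorical_cumulants s : kappa s = phi p ^+ s.+1.
Proof.
elim/ltn_ind: s => -[_|s IH]; last exact: categorical_cumulant_step.
have [q0 qS qc] := q_polys; have := congr1 phi (qS 0%N).
by rewrite q0 mulr1 linearD qc add0r big_ord1 linearZ /= phi1 mulr1 expr1.
Qed.

End CategoricalCumulants.
End FreeProducts.

(** * Moments of a measure concentrated on 0 and 1 *)

Section UnitInterval.
Variables (R : realType) (A : algType R[i]) (phi : {scalar A}).

(** The bound by 1 follows from [2 t <= t ^+ 2 + 1], integrated. *)
Lemma moments_unit_interval (x : A) (nu : probability (measurableTypeR R) R) :
  has_moments_of phi x nu -> phi (x ^+ 2) = phi x -> 0 <= phi x <= 1.
Proof.
move=> hx x2; have [i2 m2] := hx 2%N isT; have [i1 m1] := hx 1%N isT.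
rewrite expr1 in m1.
set a := Rintegral nu setT (fun t => t ^+ 1) in m1.
have a2 : Rintegral nu setT (fun t => t ^+ 2) = a.
  by have := x2; rewrite m1 m2 => -[].
rewrite m1 -(rmorph0 (real_complex R)) -(rmorph1 (real_complex R)) !lecR.
have mT : measurable (setT : set (measurableTypeR R)) by [].
have icst : nu.-integrable setT (EFin \o (fun=> 1 : R)).
  exact: finite_measure_integrable_cst.
apply/andP; split.
  by rewrite -a2; apply: Rintegral_ge0 => t _; exact: sqr_ge0.
have i2t : nu.-integrable setT (EFin \o (fun t : R => 2 * t ^+ 1)).
  exact: (integrableZl mT 2 i1).
have i1t : nu.-integrable setT (EFin \o (fun t : R => t ^+ 2 + 1)).
  exact: (integrableD mT i2 icst).
have : Rintegral nu setT (fun t => 2 * t ^+ 1) <= Rintegral nu setT (fun t => t ^+ 2 + 1).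
  apply: le_Rintegral => // t _; rewrite expr1 -subr_ge0.
  have -> : t ^+ 2 + 1 - 2 * t = (t - 1) ^+ 2 by ring.
  exact: sqr_ge0.
rewrite RintegralZl // RintegralD // a2 -/a Rintegral_cst //.
have P1 : fine (nu setT) = 1 by rewrite (@probability_setT _ _ _ nu).
rewrite P1 mul1r.
lra.
Qed.

End UnitInterval.

(** * Free categorical tuples and projections *)

Section MixedMoments.
Variables (R : realType) (A : algType R[i]) (phi : {scalar A}).
Hypothesis phi1 : phi 1 = 1.
Variables (k : nat) (b : 'I_k -> A).

Lemma two_letters_not_constant (s : seq 'I_k) l m :
  l \in s -> m \in s -> l != m -> ~~ constant s.
Proof.
case: s => // z s ls ms lm; apply: contra lm => /allP zs.
have eqz y : y \in z :: s -> y = z by rewrite inE => /orP[/eqP//|/zs/eqP].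
by rewrite (eqz l ls) (eqz m ms).
Qed.

Lemma prod_nseq_letter (l : 'I_k) n : \prod_(x <- nseq n l) b x = b l ^+ n.
Proof. by elim: n => [|n IH]; rewrite /= ?big_nil // big_cons IH exprS. Qed.

Lemma categorical_pair (q : 'I_k -> R[i]) i m r : free_categorical phi b q ->
  i != m -> phi (b m * b i ^+ r.+1) = 0.
Proof.
move=> [_ _ _ mix] im.
have := mix 2%N (fun t => if t == ord0 then m else i)
  (fun t => if t == ord0 then 1%N else r.+1) isT.
rewrite !big_ord_recl big_ord0 /= mulr1 expr1; apply=> [t|s t ts].
  by case: eqP.
have [-> ->] : s = ord0 /\ t = ord_max.
  have := ltn_ord t; rewrite ts !ltnS leqn0 => /eqP s0.
  by split; apply: val_inj; rewrite //= ts s0.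
by rewrite /=; apply/eqP; rewrite eq_sym.
Qed.

Hypothesis b_sum : \sum_(l < k) b l = 1.
Hypothesis mixed : forall s : seq 'I_k, ~~ constant s -> phi (\prod_(l <- s) b l) = 0.

(** Insert [1 = \sum_m b m] on the right: the terms with [m != l] vanish. *)
Lemma moments_stationary l n : phi (b l ^+ n.+1) = phi (b l).
Proof.
elim: n => // n <-.
rewrite -[b l ^+ n.+1 in RHS]mulr1 -b_sum mulr_sumr raddf_sum (bigD1 l) //=.
rewrite -exprSr big1 ?addr0 // => m ml.
have -> : b l ^+ n.+1 * b m = \prod_(x <- nseq n.+1 l ++ [:: m]) b x.
  by rewrite big_cat big_seq1 prod_nseq_letter.
apply: mixed; apply: (@two_letters_not_constant _ m l) => //;
  by rewrite mem_cat ?inE ?eqxx ?orbT.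
Qed.

Lemma mixed_moments_categorical : (forall l, 0 <= phi (b l) <= 1) ->
  free_categorical phi b (fun l => phi (b l)).
Proof.
move=> b01; split=> // [l [//|n] _|m i j m2 j1 cons].
  by split; [exact: moments_stationary|exact: b01].
pose s := flatten [seq nseq (j t) (i t) | t <- index_enum 'I_m].
have -> : \prod_(t < m) b (i t) ^+ j t = \prod_(l <- s) b l.
  rewrite big_flatten big_map; apply: eq_bigr => t _.
  by rewrite prod_nseq_letter.
apply: mixed; have m0 : (0 < m)%N by apply: leq_trans m2.
have si t : i t \in s.
  apply/flattenP; exists (nseq (j t) (i t)); last by rewrite mem_nseq eqxx andbT.
  by apply/mapP; exists t => //; exact: mem_index_enum.
apply: (two_letters_not_constant (si (Ordinal m0)) (si (Ordinal m2))).
exact/eqP/cons.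
Qed.

Section Star.
Variable star : A -> A.
Hypotheses (star_op : star_operation star) (star_faith : star_faithful star phi).
Hypothesis b_self : forall l, self_adjoint star (b l).

(** The square of the self-adjoint element [b l * b l - b l] has moment 0, since
    the moments of [b l] are all equal. *)
Lemma mixed_moments_projection l : projection star (b l).
Proof.
have [lin anti inv] := star_op; split=> //; apply/subr0_eq/star_faith.
have -> : star (b l * b l - b l) = b l * b l - b l.
  rewrite addrC -scaleN1r lin anti b_self.
  by rewrite rmorphN rmorph1 scaleN1r.
have e (n : nat) : phi (b l ^+ n.+1) = phi (b l) := moments_stationary l n.
have -> : (b l * b l - b l) * (b l * b l - b l) =
    b l ^+ 4 - b l ^+ 3 - (b l ^+ 3 - b l ^+ 2).
  by rewrite mulrBl !mulrBr !exprS expr0 !mulr1 !mulrA.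
by rewrite !linearB /= !e !subrr addr0.
Qed.

(** Faithfulness applies to the mixed word [b m * b l * b l * b m]. *)
Lemma mixed_moments_orthogonal l m : l <> m -> b l * b m = 0.
Proof.
move=> /eqP lm; apply: star_faith; have [_ anti _] := star_op.
rewrite anti !b_self.
have -> : b m * b l * (b l * b m) = \prod_(x <- [:: m; l; l; m]) b x.
  by rewrite !big_cons big_nil mulr1 !mulrA.
by apply: mixed; apply: (@two_letters_not_constant _ l m); rewrite ?inE ?eqxx ?orbT.
Qed.

End Star.
End MixedMoments.

Theorem theorem5p3 (R : realType) (A : algType R[i]) (phi : {scalar A})
    (phi1 : phi 1 = 1) (k : nat) (p : A) (b : 'I_k -> A)
    (p_b_free : free_pair phi [set p] (range b))
    (b_sum : \sum_(l < k) b l = 1)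
    (b_moments : forall l : 'I_k,
      exists nu : probability (measurableTypeR R) R,
        has_moments_of phi (b l) nu)
    (pb_free : free_elements phi (fun l : 'I_k => p * b l)) :
  (forall q : 'I_k -> R[i],
     free_categorical phi b q ->
     (exists i : 'I_k, 0 < q i < 1) ->
     0 < phi p ->
     free_poisson phi p 1 (phi p))
  /\
  (free_poisson_rate phi p 1 ->
     (exists q : 'I_k -> R[i], free_categorical phi b q)
     /\
     (forall star : A -> A,
        star_operation star ->
        star_positive star phi ->
        star_faithful star phi ->
        (forall l : 'I_k, self_adjoint star (b l)) ->
        (forall l : 'I_k, projection star (b l)) /\
        (forall l m : 'I_k, l <> m -> b l * b m = 0))).
Proof.
split=> [q cat [i /andP[qi0 qi1]] p0|[alpha [_ alpha0 cum]]].
  have [qE _ _ _] := cat; rewrite qE in qi0 qi1.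
  have [m im bm0] : exists2 m, i != m & phi (b m) != 0.
    have [/existsP[m /andP[]]|none] := boolP [exists m, (i != m) && (phi (b m) != 0)].
      by exists m.
    have := congr1 phi b_sum; rewrite phi1 raddf_sum (bigD1 i) //= big1 => [|m mi].
      by rewrite addr0 => e; rewrite e ltxx in qi1.
    move: none; rewrite negb_exists => /forallP/(_ m).
    by rewrite eq_sym mi /= negbK => /eqP.
  have [kappa [r r_polys]] := cumulant_polynomials_exist phi1 p.
  have kE s : kappa s = phi p ^+ s.+1.
    have bi0 : phi (b i) != 0 by rewrite gt_eqF.
    apply: (categorical_cumulants phi1 p_b_free pb_free im _ bi0 bm0 r_polys).
    by move=> n; apply: categorical_pair cat im.
  have [r0 rS rc] := r_polys.
  have rS' n : p * r n = r n.+1 + \sum_(s < n.+1) phi p ^+ s.+1 *: r (n - s)%N.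
    by rewrite rS; congr (_ + _); apply: eq_bigr => s _; rewrite kE.
  have /(catalan_momentsP phi1 r0 rS')/(poisson_momentsP phi1) cum := rc.
  by split=> // n n1; rewrite mul1r cum.
have mom : forall n, phi (p ^+ n) = alpha ^+ n * (catalan n)%:R.
  by apply/(poisson_momentsP phi1) => n n1; rewrite cum // mul1r.
have an0 : alpha != 0 by rewrite gt_eqF.
have mixed s := poisson_mixed_moments phi1 p_b_free (s := s) pb_free an0 mom.
split=> [|star st _ faith self].
  exists (fun l => phi (b l)); apply: mixed_moments_categorical => // l.
  by have [nu /moments_unit_interval] := b_moments l; apply; apply: moments_stationary.
split=> [l|l m].
  exact: (mixed_moments_projection b_sum mixed st faith self).
exact: (mixed_moments_orthogonal mixed st faith self).
Qed.
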